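(* Let $n\geq 3$ and let $\mathbb{BP}_n$ be the burnt pancake graph. Then \[ \gamma(\mathbb{BP}_n)\leq 2^{n-4}(4n-9)\,n!+1 . \]
   Context: For a graph $G$, $\gamma(G)$ denotes its genus: the minimum genus of a closed orientable surface on which $G$ can be embedded without edge crossings. The burnt pancake graph $\mathbb{BP}_n$ is the simple undirected graph whose vertex set is the set of signed permutations of $[n]$. These are words $\pi_1^{a_1}\cdots\pi_n^{a_n}$, where $\pi_1\cdots\pi_n$ is a permutation of $[n]$ and each sign $a_j\in\{+,-\}$; there are $2^n n!$ of them. For $1\le i\le n$ the prefix reversal $r_i$ reverses the order of the first $i$ entries and flips the sign of each of those $i$ entries, leaving the rest unchanged. Two vertices $\pi,\sigma$ are adjacent iff $\sigma=r_i(\pi)$ for some $1\le i\le n$. Hence $\mathbb{BP}_n$ has $2^n n!$ vertices and $2^{n-1}n!\,n$ edges. *)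

(* Defs.v *)
From mathcomp Require Import all_boot all_order all_algebra.
From mathcomp Require Import all_classical all_reals all_analysis.
Set Implicit Arguments.
Unset Strict Implicit.
Unset Printing Implicit Defensive.
Import Order.TTheory GRing.Theory Num.Theory.
Import numFieldNormedType.Exports.
Local Open Scope classical_set_scope.
Local Open Scope ring_scope.

(* A and B carry the subspace topologies; the values of f outside A and of h
   outside B are irrelevant. *)
Definition homeomorphic (T U : topologicalType) (A : set T) (B : set U) : Prop :=
  exists (f : T -> U) (h : U -> T),
    [/\ {within A, continuous f}, {within B, continuous h},
        f @` A `<=` B & h @` B `<=` A] /\
    (forall x, A x -> h (f x) = x) /\ (forall y, B y -> f (h y) = y).

Definition closed_surface (R : realType) (X : topologicalType) : Prop :=
  [/\ hausdorff_space X, compact [set: X], connected [set: X] &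
      forall x : X, exists (U : set X) (V : set (R * R)),
        [/\ open U, U x, open V & homeomorphic U V]].

Definition simplicial_complex (N : nat) (K : {set {set 'I_N}}) : Prop :=
  finset.set0 \notin K /\
  forall s t : {set 'I_N},
    s \in K -> t \subset s -> t != finset.set0 -> t \in K.

Definition polyhedron (R : realType) (N : nat) (K : {set {set 'I_N}}) :
    set 'rV[R]_N :=
  [set x : 'rV[R]_N | [/\ forall i, 0 <= x ord0 i, \sum_i x ord0 i = 1 &
                          finset (fun i => x ord0 i != 0) \in K]].

Definition euler_characteristic (N : nat) (K : {set {set 'I_N}}) : int :=
  \sum_(s in K) (-1) ^+ #|s|.-1.

Definition is_triangle (N : nat) (K : {set {set 'I_N}}) (a b c : 'I_N) : bool :=
  uniq [:: a; b; c] && ([set a; b; c]%SET \in K).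

(* O a b c says that the cyclic order (a, b, c) is the chosen orientation of the
   triangle {a, b, c}.  The last clause says that two triangles abc and abd with
   a common edge induce opposite directions on that edge. *)
Definition orientable (N : nat) (K : {set {set 'I_N}}) : Prop :=
  exists O : 'I_N -> 'I_N -> 'I_N -> bool,
    (forall a b c, is_triangle K a b c ->
       O b c a = O a b c /\ O b a c = ~~ O a b c) /\
    (forall a b c d, is_triangle K a b c -> is_triangle K a b d -> c != d ->
       O a b d = ~~ O a b c).

(* Orientability and genus are read off a triangulation; the Euler
   characteristic of the closed orientable surface of genus g is 2 - 2g. *)
Definition closed_orientable_surface (R : realType) (X : topologicalType)
    (g : nat) : Prop :=
  closed_surface R X /\
  exists (N : nat) (K : {set {set 'I_N}}),
    [/\ simplicial_complex K, forall s, s \in K -> (#|s| <= 3)%N,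
        homeomorphic (@polyhedron R N K) [set: X], orientable K &
        euler_characteristic K = 2 - 2 * g%:Z].

(* Drawing without crossings in X of the simple graph with adjacency relation e:
   p places the vertices, and c u v, restricted to [0, 1], is the arc drawn for
   the edge uv; c v u is the same arc traversed backwards. *)
Definition is_embedding (R : realType) (V : finType) (e : rel V)
    (X : topologicalType) (p : V -> X) (c : V -> V -> R -> X) : Prop :=
  injective p /\
  (forall u v, e u v ->
     [/\ {within `[0, 1], continuous (c u v)},
         {in `[0, 1] &, injective (c u v)},
         c u v 0 = p u, c u v 1 = p v &
         {in `[0, 1], forall t, c v u t = c u v (1 - t)}]) /\
  (forall u v w, e u v -> {in `]0, 1[, forall t, c u v t <> p w}) /\
  (forall u v u' v', e u v -> e u' v' -> [set u; v]%SET != [set u'; v']%SET ->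
     {in `]0, 1[ &, forall s t, c u v s <> c u' v' t}).

Definition embeds_in_genus (R : realType) (V : finType) (e : rel V)
    (g : nat) : Prop :=
  exists X : topologicalType, closed_orientable_surface R X g /\
  exists (p : V -> X) (c : V -> V -> R -> X), is_embedding e p c.

Definition is_genus (R : realType) (V : finType) (e : rel V) (g : nat) : Prop :=
  embeds_in_genus R e g /\ forall h, embeds_in_genus R e h -> (g <= h)%N.

(* The letter (k, b) is k + 1 with sign - when b is true and + when b is false. *)
Definition signed_permutation (n : nat) :=
  {w : n.-tuple ('I_n * bool) | uniq [seq x.1 | x <- w]}.

Definition prefix_reversal (T : Type) (i : nat) (w : seq (T * bool)) :
    seq (T * bool) :=
  rev [seq (x.1, ~~ x.2) | x <- take i w] ++ drop i w.

Definition burnt_pancake (n : nat) : rel (signed_permutation n) :=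
  fun u v => [exists i : 'I_n,
    (val (val v) : seq _) == prefix_reversal i.+1 (val (val u))].

Lemma prefix_reversalK (T : Type) (i : nat) (w : seq (T * bool)) :
  prefix_reversal i (prefix_reversal i w) = w.
Proof.
rewrite /prefix_reversal; set a := rev [seq _ | x <- take i w].
have aK : rev [seq (x.1, ~~ x.2) | x <- a] = take i w.
  rewrite /a map_rev revK.
  by elim: (take i w) => //= -[x b] s ->; rewrite negbK.
have sa : size a = size (take i w) by rewrite size_rev size_map.
have [iw|/ltnW wi] := leqP i (size w).
  have ai : size a = i by rewrite sa size_takel.
  by rewrite take_size_cat // drop_size_cat // aK cat_take_drop.
have ai : (size a <= i)%N by rewrite sa take_oversize.
by rewrite (drop_oversize wi) cats0 take_oversize // drop_oversize // cats0 aK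
  take_oversize.
Qed.

Lemma burnt_pancake_sym (n : nat) : symmetric (@burnt_pancake n).
Proof.
by move=> u v; apply/existsP/existsP => -[i /eqP vu]; exists i;
  rewrite vu prefix_reversalK.
Qed.

Lemma burnt_pancake_irrefl (n : nat) : irreflexive (@burnt_pancake n).
Proof.
move=> u; apply/existsP => -[i /eqP].
case: u => w /=; move: (size_tuple w); move: {w}(tval w) => w sw uw E.
have iw : (i.+1 <= size w)%N by rewrite sw.
set a := take i.+1 w.
have aE : a = rev [seq (x.1, ~~ x.2) | x <- a].
  rewrite {1}/a {1}E /prefix_reversal take_size_cat //.
  by rewrite size_rev size_map size_takel.
have ua : uniq [seq x.1 | x <- a].
  by move: uw; rewrite -{1}(cat_take_drop i.+1 w) map_cat cat_uniq => /andP[].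
have sa : size a = i.+1 by rewrite size_takel.
have [x xa] : exists x, x \in a.
  by case: (a) sa => // x s _; exists x; rewrite mem_head.
have : x \in [seq (x.1, ~~ x.2) | x <- a] by rewrite -mem_rev -aE.
case/mapP => y ya xy.
suff xE : x = y by move: xy; rewrite -xE; case: (x) => k [].
have [j ja jx] := nthP x xa; have [k ka ky] := nthP x ya.
have : nth x.1 [seq x.1 | x <- a] j == nth x.1 [seq x.1 | x <- a] k.
  by rewrite !(nth_map x) // jx ky xy.
by rewrite nth_uniq ?size_map // => /eqP jk; rewrite -jx -ky jk.
Qed.

(* Main.v *)
Require Import Defs.
From mathcomp Require Import all_boot all_order all_algebra.
From mathcomp Require Import all_fingroup.
From mathcomp Require Import all_classical all_reals all_analysis.
From mathcomp Require Import ring lra zify.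
Set Implicit Arguments.
Unset Strict Implicit.
Unset Printing Implicit Defensive.
Import Order.TTheory GRing.Theory Num.Theory.
Import numFieldNormedType.Exports.

(* Colour the signed permutations so that r_1 and r_2 both switch colours, and
   rotate the edges at u as r_1, ..., r_n or r_n, ..., r_1 according to the
   colour of u.  Then every walk r_1 r_2 r_1 r_2 ... bounds a face, and such a
   face has length 8 since (r_1 r_2)^4 = 1.  They pass once through each vertex,
   so there are at least 2^n n! / 8 faces, and the bound is Euler's formula.
   The surface is the polyhedron of a triangulation read off the rotation
   system; its charts are the open stars of vertices, mapped onto the interior of
   regular polygons. *)

(** * Prefix reversals *)

(** A face walk that enters a vertex by r_i leaves it by a neighbour of r_i in the rotation. With
    one rotation at every vertex the index would drift in one direction around each face; opposite
    rotations at the two ends of every r_1 and r_2 edge turn it back, so that the walk alternates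
    between the two. Of all other faces only the absence of lengths below 4 matters. A simplicial
    complex is a family of vertex sets, so loops, parallel edges and short faces would identify
    simplices; the distinctness and no-triangle lemmas on reversals serve to exclude them. Links of
    length at least 4 also keep two consecutive steps around the regular polygon within half a turn,
    which allows the barycentric coordinates to be written as a clipped minimum of two determinants.
    The genus has to be a natural number: that the Euler characteristic is at most 2 comes from a
    rank inequality over the rationals, and that it is even from signs of permutations. *)

Section PrefixReversal.
Variable T : eqType.
Implicit Types (w s t : seq (T * bool)) (x : T * bool).

Let neg x := (x.1, ~~ x.2).

Lemma size_prefix_reversal i w : size (prefix_reversal i w) = size w.
Proof.
by rewrite /prefix_reversal size_cat size_rev size_map -size_cat cat_take_drop.
Qed.

Lemma perm_prefix_reversal i w :
  perm_eq [seq x.1 | x <- prefix_reversal i w] [seq x.1 | x <- w].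
Proof.
rewrite /prefix_reversal -[in X in perm_eq _ X](cat_take_drop i w) !map_cat.
rewrite perm_cat2r map_rev perm_rev -map_comp.
by rewrite (@eq_map _ _ _ (fun x => x.1)).
Qed.

Lemma nth_prefix_reversal_out x0 i k w : i <= k ->
  nth x0 (prefix_reversal i w) k = nth x0 w k.
Proof.
move=> ik; rewrite /prefix_reversal nth_cat size_rev size_map size_take.
case: (ltnP i (size w)) => [iw|wi].
  by rewrite ltnNge ik /= nth_drop subnKC.
rewrite (drop_oversize wi) ltnNge (leq_trans wi ik) /=.
by rewrite !nth_default // ?subn_gt0 // (leq_trans wi ik).
Qed.

Lemma nth_prefix_reversal_last x0 k w : k < size w ->
  nth x0 (prefix_reversal k.+1 w) k = neg (nth x0 w 0).
Proof.
case: w => [//|y w] kw; rewrite /prefix_reversal /= rev_cons cat_rcons nth_cat.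
by rewrite size_rev size_map size_takel // ltnn subnn.
Qed.

(** Position [k] receives the symbol that stood first, which differs from its own. This is how
    reversals of different lengths are told apart. *)
Lemma nth_prefix_reversal_neq x0 k w : uniq [seq x.1 | x <- w] ->
  0 < k < size w -> nth x0 (prefix_reversal k.+1 w) k != nth x0 w k.
Proof.
move=> uw /andP[k0 kw]; rewrite nth_prefix_reversal_last //.
apply/eqP => /(congr1 fst) /= /eqP.
rewrite -!(nth_map _ x0.1 (fun x => x.1)) ?(leq_trans _ kw) //.
by rewrite nth_uniq ?size_map ?(leq_trans _ kw) // eq_sym gtn_eqF.
Qed.

Lemma prefix_reversal_inj_index i j w : uniq [seq x.1 | x <- w] ->
  i < size w -> j < size w ->
  prefix_reversal i.+1 w = prefix_reversal j.+1 w -> i = j.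
Proof.
case: w => [//|y v]; have x0 := y; move: (y :: v) => {y v} w uw.
wlog ij : i j / i < j => [wl|] iw jw E.
  have [ij|ij|//] := ltngtP i j; first exact: wl ij iw jw E.
  by apply/esym; exact: (wl j i ij jw iw (esym E)).
have := @nth_prefix_reversal_neq x0 j w uw; rewrite jw (leq_trans _ ij) // => /(_ isT).
by rewrite -E nth_prefix_reversal_out // eqxx.
Qed.

(* The longest of the three reversals moves a letter that the other two fix. *)
Lemma prefix_reversal_no_triangle i j k w : uniq [seq x.1 | x <- w] ->
  i < size w -> j < size w -> k < size w -> i != j -> j != k -> k != i ->
  prefix_reversal k.+1 (prefix_reversal j.+1 (prefix_reversal i.+1 w)) <> w.
Proof.
have max m a b v : uniq [seq x.1 | x <- v] -> m < size v -> a < m -> b < m ->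
    prefix_reversal a.+1 (prefix_reversal b.+1 v) <> prefix_reversal m.+1 v.
  case: v => [//|y v']; have x0 := y; move: (y :: v') => {y v'} v uv mv am bm E.
  have := @nth_prefix_reversal_neq x0 m v uv.
  rewrite mv (leq_trans _ am) // => /(_ isT).
  by rewrite -E !nth_prefix_reversal_out // eqxx.
move=> uw iw jw kw ij jk ki E.
(* The relation is rotated cyclically so that the longest reversal stands alone on one side; if it
   is [j], the base point moves to [v]. *)
have E1 : prefix_reversal j.+1 (prefix_reversal i.+1 w) = prefix_reversal k.+1 w.
  by rewrite -{2}E prefix_reversalK.
have E2 : prefix_reversal j.+1 (prefix_reversal k.+1 w) = prefix_reversal i.+1 w.
  by rewrite -E1 prefix_reversalK.
pose v := prefix_reversal i.+1 w.
have uv : uniq [seq x.1 | x <- v] by rewrite (perm_uniq (perm_prefix_reversal _ _)).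
have E3 : prefix_reversal k.+1 (prefix_reversal i.+1 v) = prefix_reversal j.+1 v.
  by rewrite /v prefix_reversalK -E1.
have [kij|nk] := boolP ((i < k) && (j < k)).
  by case/andP: kij => ik jk'; exact: (max k j i w uw kw jk' ik E1).
have [ijk|ni] := boolP ((j < i) && (k < i)).
  by case/andP: ijk => ji ki'; exact: (max i j k w uw iw ji ki' E2).
apply: (max j k i v uv _ _ _ E3); rewrite ?size_prefix_reversal //;
  move: ij jk ki nk ni; lia.
Qed.

Lemma prefix_reversal_rcons i w x : i <= size w ->
  prefix_reversal i (rcons w x) = rcons (prefix_reversal i w) x.
Proof.
move=> iw; rewrite /prefix_reversal -cats1 takel_cat // drop_cat.
case: ltngtP iw => // [iw _|-> _]; first by rewrite catA cats1.
by rewrite subnn drop0 drop_size cats0 cats1.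
Qed.

Lemma perm_prefix_reversals w l :
  perm_eq [seq x.1 | x <- foldl (fun v i => prefix_reversal i v) w l]
          [seq x.1 | x <- w].
Proof.
elim: l w => //= i l IHl w.
exact: perm_trans (IHl _) (perm_prefix_reversal _ _).
Qed.

Lemma prefix_reversals_rcons w x l : all (fun i => i <= size w) l ->
  foldl (fun v i => prefix_reversal i v) (rcons w x) l =
  rcons (foldl (fun v i => prefix_reversal i v) w l) x.
Proof.
elim: l w => //= i l IHl w /andP[iw lw]; rewrite prefix_reversal_rcons // IHl //.
by rewrite size_prefix_reversal.
Qed.

(** Pancake sorting: the last letter of [t] is brought to the front, given the right sign, and sent
    to the end by the full reversal; the rest is sorted by shorter reversals, which leave it in
    place. *)
Lemma prefix_reversals_sort s t :
  perm_eq [seq x.1 | x <- s] [seq x.1 | x <- t] ->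
  exists l, all (fun i => 0 < i <= size s) l /\
            foldl (fun w i => prefix_reversal i w) s l = t.
Proof.
elim/last_ind: t s => [|t x IHt] s st.
  have := perm_size st; rewrite size_map => /size0nil ->; by exists [::].
have : x.1 \in [seq y.1 | y <- s].
  by rewrite (perm_mem st) map_rcons mem_rcons mem_head.
case/mapP => -[y b] ys /= xy; case/splitPr: ys st => s1 s2 st.
have pr1 : prefix_reversal (size s1).+1 (s1 ++ (y, b) :: s2) =
    (y, ~~ b) :: rev [seq neg z | z <- s1] ++ s2.
  rewrite /prefix_reversal -cat_rcons -(size_rcons s1 (y, b)) take_size_cat //.
  by rewrite drop_size_cat // map_rcons rev_rcons.
set r := rev _ ++ s2 in pr1.
have [l0 [l0E l0P]] : exists l0, all (fun i => 0 < i <= (size s1 + size s2).+1) l0 /\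
    foldl (fun w i => prefix_reversal i w) (s1 ++ (y, b) :: s2) l0 =
    (y, ~~ x.2) :: r.
  (* The full reversal will negate the front letter once more, so it must carry the sign opposite to
     that of [x]; r_1 repairs it otherwise. *)
  have [bx|bx] := eqVneq b x.2.
    exists [:: (size s1).+1]; rewrite /= pr1 bx; split=> //.
    by rewrite andbT ltnS leq_addr.
  exists [:: (size s1).+1; 1]; rewrite /= pr1 /prefix_reversal /= take0 drop0 /=.
  split; first by rewrite andbT ltnS leq_addr.
  by congr ((_, ~~ _) :: _); move: bx; case: (b); case: (x.2).
have rs : size r = size s1 + size s2 by rewrite size_cat size_rev size_map.
have prs : prefix_reversal (size r).+1 ((y, ~~ x.2) :: r) = rcons (rev [seq neg z | z <- r]) x.
  rewrite /prefix_reversal /= take_size drop_size cats0 rev_cons negbK -xy.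
  by case: (x).
have st' : perm_eq [seq z.1 | z <- rev [seq neg z | z <- r]] [seq z.1 | z <- t].
  have := perm_prefix_reversal (size r).+1 ((y, ~~ x.2) :: r); rewrite prs.
  move=> p1.
  have p2 : perm_eq [seq z.1 | z <- (y, ~~ x.2) :: r] [seq z.1 | z <- s1 ++ (y, b) :: s2].
    by rewrite -l0P; exact: perm_prefix_reversals.
  have := perm_trans p1 (perm_trans p2 st); rewrite !map_rcons -!cats1.
  by rewrite perm_cat2r.
have [l [lE lP]] := IHt _ st'.
rewrite size_rev size_map rs in lE.
have ls : size (s1 ++ (y, b) :: s2) = (size s1 + size s2).+1 by rewrite size_cat addnS.
exists (l0 ++ (size r).+1 :: l); split.
  rewrite ls all_cat l0E /= rs ltnSn /=; apply: sub_all lE => i /andP[-> /leqW].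
  exact.
rewrite foldl_cat l0P /= prs prefix_reversals_rcons ?lP //.
by apply: sub_all lE => i /andP[_]; rewrite size_rev size_map rs.
Qed.

End PrefixReversal.

Local Open Scope ring_scope.

(** * Regular polygons *)

Lemma periodic_sum (V : nmodType) (k i : nat) (F : nat -> V) :
  (forall j, F (j + k)%N = F j) ->
  \sum_(m < k) F (i + m)%N = \sum_(m < k) F m.
Proof.
move=> Fk; elim: i => [//|i <-].
case: k Fk => [|k] Fk; first by rewrite !big_ord0.
rewrite big_ord_recr big_ord_recl /= addrC addn0.
rewrite addSnnS Fk; congr (_ + _); apply: eq_bigr => m _.
by rewrite addSnnS.
Qed.

Definition cross (R : realType) (p q : R * R) : R := p.1 * q.2 - p.2 * q.1.

Section RegularPolygon.
Variables (R : realType) (k : nat).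
Hypothesis k_ge4 : (4 <= k)%N.

Let angle : R := pi *+ 2 / k%:R.

Definition ngon (i : nat) : R * R := (cos (angle * i%:R), sin (angle * i%:R)).

(* [i + k.-1] stands for the predecessor of [i] modulo [k]. *)
Definition hat (i : nat) (y : R * R) : R :=
  Num.max 0 (Num.min (cross y (ngon i.+1)) (cross (ngon (i + k.-1)) y)) /
  sin angle.

Let k_gt0 : 0 < k%:R :> R.
Proof. by rewrite ltr0n; case: k k_ge4. Qed.

Let angle_k : angle * k%:R = pi *+ 2.
Proof. by rewrite /angle divfK // gt_eqF. Qed.

Let angle_gt0 : 0 < angle.
Proof. by rewrite divr_gt0 // pmulrn_lgt0 // pi_gt0. Qed.

Let angle4 : angle *+ 4 <= pi *+ 2.
Proof.
by rewrite -angle_k -[leLHS]mulr_natr ler_pM2l // ler_nat.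
Qed.

Let sin_angle_gt0 : 0 < sin angle.
Proof.
apply: sin_gt0_pi; rewrite angle_gt0 /=.
by move: angle4 (pi_gt0 R); rewrite -[leLHS]mulr_natr -[leRHS]mulr_natr; lra.
Qed.

Let sin_angleM_ge0 m : (m.*2 <= k)%N -> 0 <= sin (angle * m%:R).
Proof.
move=> mk; apply: sin_ge0_pi.
rewrite mulr_ge0 ?(ltW angle_gt0) //=.
rewrite -(@ler_pMn2r _ 2) // -angle_k -mulrnAr -mulrnA ler_pM2l // ler_nat.
by rewrite muln2.
Qed.

Let sin_angleM_le0 m : (k <= m.*2)%N -> (m <= k)%N -> sin (angle * m%:R) <= 0.
Proof.
move=> km mk; have -> : angle * m%:R = - (angle * (k - m)%:R) + pi *+ 2.
  by rewrite natrB // mulrBr angle_k; ring.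
rewrite sinD2pi sinN oppr_le0; apply: sin_angleM_ge0.
by rewrite doubleB leq_subLR -addnn leq_add2r.
Qed.

Lemma ngonDk i : ngon (i + k) = ngon i.
Proof. by rewrite /ngon natrD mulrDr angle_k cosD2pi sinD2pi. Qed.

Lemma hatDk i y : hat (i + k) y = hat i y.
Proof. by rewrite /hat -addSn ngonDk addnAC ngonDk. Qed.

Let cross_ngon i m : cross (ngon i) (ngon (i + m)) = sin (angle * m%:R).
Proof.
rewrite /cross /ngon /= natrD mulrDr.
set x := angle * i%:R; set y := angle * m%:R.
have -> : sin y = sin (x + y - x) by congr sin; ring.
by rewrite sinB; ring.
Qed.

Let crossN (p q : R * R) : cross p q = - cross q p.
Proof. by rewrite /cross opprB mulrC [q.1 * _]mulrC. Qed.

Let cross_comb (p q r : R * R) a b :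
  cross p (a * q.1 + b * r.1, a * q.2 + b * r.2) = a * cross p q + b * cross p r.
Proof. by rewrite /cross /=; ring. Qed.

Let cross_ngonDk i j m : (i + m = j + k)%N ->
  cross (ngon i) (ngon j) = sin (angle * m%:R).
Proof. by move=> ij; rewrite -(ngonDk j) -ij cross_ngon. Qed.

Let predkK : k.-1.+1 = k.
Proof. by rewrite prednK //; case: k k_ge4. Qed.

(** [hat i] is piecewise linear along the rays through the corners, 1 at corner [i] and 0 at the
    others. Within a sector the hats are therefore the coefficients of [y] on its two corners. *)
Lemma hat_sector i m a b : (m < k)%N -> 0 <= a -> 0 <= b ->
  hat (i + m) (a * (ngon i).1 + b * (ngon i.+1).1,
               a * (ngon i).2 + b * (ngon i.+1).2) =
  a *+ (m == 0)%N + b *+ (m == 1)%N.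
Proof.
move=> mk a0 b0; rewrite /hat crossN 2!cross_comb.
have -> : cross (ngon (i + m).+1) (ngon i) = - sin (angle * m.+1%:R).
  by rewrite crossN -addnS cross_ngon.
have -> : cross (ngon (i + m).+1) (ngon i.+1) = - sin (angle * m%:R).
  by rewrite crossN -addSn cross_ngon.
case: m mk => [|[|m]] mk; rewrite /= ?mulr1n ?mulr0n ?addr0 ?add0r ?mulr1.
- rewrite (@cross_ngonDk _ i 1) ?(@cross_ngonDk _ i.+1 2); try by move: predkK; lia.
  (* Four or more corners keep twice the angle within half a turn, so the minimum picks the
     determinant that isolates one coefficient. *)
  have s2 : 0 <= sin (angle * 2) by apply: (sin_angleM_ge0 (m := 2)).
  rewrite mulr0 sin0 oppr0 mulr0 addr0 mulr1 mulrN opprK min_l; last first.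
    by rewrite lerDl mulr_ge0.
  by rewrite max_r ?mulfK ?gt_eqF // mulr_ge0 // ltW.
- rewrite (@cross_ngonDk _ i 0) ?(@cross_ngonDk _ i.+1 1); try by move: predkK; lia.
  have s2 : 0 <= sin (angle * 2) by apply: (sin_angleM_ge0 (m := 2)).
  rewrite mulr0 sin0 mulr0 add0r mulr1 !mulrN opprD !opprK min_r; last first.
    by rewrite lerDr mulr_ge0.
  by rewrite max_r ?mulfK ?gt_eqF // mulr_ge0 // ltW.
have iE : (i + m.+2 + k.-1 = i.+1 + m + k)%N.
  by rewrite -[in RHS]predkK !addnS !addSn.
rewrite iE ngonDk.
have -> : cross (ngon (i.+1 + m)) (ngon i) = - sin (angle * m.+1%:R).
  by rewrite crossN addSnnS cross_ngon.
have -> : cross (ngon (i.+1 + m)) (ngon i.+1) = - sin (angle * m%:R).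
  by rewrite crossN cross_ngon.
rewrite max_l ?mul0r // ge_min !mulrN !opprD !opprK -!opprD.
(* Up to half a turn from the sector the second determinant is nonpositive, beyond it the first, so
   the hat vanishes in both cases. *)
have [mk2|km2] := leqP m.+1.*2 k; apply/orP; [right|left].
  rewrite oppr_le0 addr_ge0 // mulr_ge0 // sin_angleM_ge0 //.
  by rewrite (leq_trans _ mk2) // leq_double.
rewrite -[_ + _]opprK oppr_le0 opprD addr_ge0 // -mulrN mulr_ge0 //;
  rewrite oppr_ge0 sin_angleM_le0 //; lia.
Qed.

(** The determinants [d i] satisfy a three-term recurrence; summed over a period it gives them sum
    0. They can then be neither all positive nor all negative, so somewhere [d] passes from
    nonnegative to nonpositive, and that sector contains [y]. *)
Lemma ngon_sector (y : R * R) : exists (i : nat) (a b : R),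
  [/\ (i < k)%N, 0 <= a, 0 <= b &
      y = (a * (ngon i).1 + b * (ngon i.+1).1,
           a * (ngon i).2 + b * (ngon i.+1).2)].
Proof.
pose d i := cross (ngon i) y.
have dk i : d (i + k)%N = d i by rewrite /d ngonDk.
have d2 i : d i + d i.+2 = 2 * cos angle * d i.+1.
  rewrite /d /cross /ngon /=; set x := angle * i%:R.
  have -> : angle * i.+1%:R = x + angle by rewrite -natr1 /x; ring.
  have -> : angle * i.+2%:R = x + angle + angle by rewrite -!natr1 /x; ring.
  rewrite -[x in cos x * _ - _](addrK angle).
  have -> : sin x = sin (x + angle - angle) by congr sin; ring.
  by rewrite cosB sinB ![in LHS](cosD (x + _)) ![in LHS](sinD (x + _)); ring.
have sd : \sum_(i < k) d i = 0.
  have shift (F : nat -> R) : (forall j, F (j + k)%N = F j) ->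
      \sum_(i < k) F i.+1 = \sum_(i < k) F i.
    exact: (periodic_sum 1).
  have cos1 : cos angle != 1.
    apply/eqP => c1; have := cos2Dsin2 angle; rewrite c1 expr1n => /eqP.
    by rewrite addrC -subr_eq0 addrK sqrf_eq0 gt_eqF.
  have : \sum_(i < k) (d i + d i.+2) = \sum_(i < k) (2 * cos angle * d i.+1).
    by apply: eq_bigr.
  rewrite big_split -mulr_sumr /= (shift (fun i => d i.+1)); last first.
    by move=> j; rewrite -addSn dk.
  rewrite (shift d dk).
  move=> E; have /eqP : 2 * (1 - cos angle) * \sum_(i < k) d i = 0.
    by rewrite mulrBr mulrBl -E; ring.
  by rewrite !mulf_eq0 pnatr_eq0 /= subr_eq0 eq_sym (negPf cos1) => /eqP.
have [i ik [di di1]] : exists2 i, (i < k)%N & 0 <= d i /\ d i.+1 <= 0.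
  apply: contrapT => nsec.
  have dpos i : 0 <= d i -> 0 < d i.+1.
    move=> di; rewrite ltNge; apply/negP => di1; apply: nsec.
    exists (i %% k)%N; first by rewrite ltn_mod; case: k k_ge4.
    have dmod j : d (i + j)%N = d (i %% k + j)%N.
      rewrite {1}(divn_eq i k); elim: (i %/ k)%N => [|q IHq] //.
      by rewrite mulSn -2!addnA addnC dk addnA.
    by rewrite -[(i %% k).+1]addn1 -dmod addn1 -[(i %% k)%N]addn0 -dmod addn0.
  have [[i di]|nd] := pselect (exists i, 0 <= d i).
    have dall j : 0 < d (i + j.+1)%N.
      elim: j => [|j IHj]; first by rewrite addn1 dpos.
      by rewrite addnS dpos // ltW.
    have dall' j : 0 < d j.
      have jk q : d j = d (j + q * k)%N.
        by elim: q => [|q IHq]; rewrite ?addn0 // mulSn addnCA addnC dk.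
      (* Adding [i.+1] periods moves the index past [i], where positivity is known. *)
      rewrite (jk i.+1) mulSn.
      have -> : (j + (k + i * k) = i + (j + k.-1 + i * k.-1).+1)%N.
        by rewrite -{1 2}predkK mulnS; lia.
      exact: dall.
    have : 0 < \sum_(i < k) d i.
      rewrite (bigD1 (Ordinal (ltnW (ltnW (ltnW k_ge4))))) //=.
      by rewrite ltr_pwDl // sumr_ge0 // => j _; exact: ltW.
    by rewrite sd ltxx.
  have dneg j : d j < 0 by rewrite ltNge; apply/negP => dj; apply: nd; exists j.
  have : \sum_(i < k) d i < 0.
    rewrite -oppr_gt0 -sumrN (bigD1 (Ordinal (ltnW (ltnW (ltnW k_ge4))))) //=.
    by rewrite ltr_pwDl ?oppr_gt0 // sumr_ge0 // => j _; rewrite oppr_ge0 ltW.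
  by rewrite sd ltxx.
have s0 := sin_angle_gt0; have sn0 : sin angle != 0 by rewrite gt_eqF.
(* Cramer's rule: [sin angle] is the determinant of two consecutive corners. *)
exists i, (- d i.+1 / sin angle), (d i / sin angle); split => //.
- by rewrite divr_ge0 ?oppr_ge0 // ltW.
- by rewrite divr_ge0 // ltW.
have sE : sin angle = (ngon i).1 * (ngon i.+1).2 - (ngon i).2 * (ngon i.+1).1.
  by rewrite -[LHS](_ : cross (ngon i) (ngon i.+1) = _) // -addn1 cross_ngon mulr1.
rewrite /d /cross; case: y {d dk d2 sd di di1} => y1 y2; rewrite [LHS]/=.
have clear_sin A B p q :
    (A / sin angle * p + B / sin angle * q) * sin angle = A * p + B * q.
  by field.
by congr pair; apply: (mulIf sn0); rewrite clear_sin sE;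
  move: (ngon i) (ngon i.+1) => [p1 p2] [q1 q2] /=; ring.
Qed.

End RegularPolygon.

(** * Complexes of oriented triangles *)

(* [O a b c] says that abc is a positively oriented triangle, so that the link
   of v is traversed by the relation [O v]. *)
Record oriented_surface (W : finType) (O : W -> W -> W -> bool) : Prop := {
  os_rot : forall a b c, O a b c -> O b c a;
  os_fun : forall a b c d, O a b c -> O a b d -> c = d;
  os_opp : forall a b c, O a b c -> exists d, O b a d;
  os_asym : forall a b c, O a b c -> ~~ O b a c;
  os_link : forall v a b c d, O v a b -> O v c d -> connect (O v) a c;
  os_link_ge4 : forall v a b c, O v a b -> O v b c -> ~~ O v c a;
  os_conn : forall a b c a' b' c', O a b c -> O a' b' c' ->
    connect (fun x y => [exists z, O x y z]) a a' }.

Definition complex_of (N : nat) (O : 'I_N -> 'I_N -> 'I_N -> bool) :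
    {set {set 'I_N}} :=
  finset (fun s : {set 'I_N} => (s != finset.set0) &&
    [exists t : 'I_N * 'I_N * 'I_N,
      O t.1.1 t.1.2 t.2 && (s \subset [set t.1.1; t.1.2; t.2]%SET)]).

Section Complex.
Variables (N : nat) (O : 'I_N -> 'I_N -> 'I_N -> bool).
Hypothesis surfO : oriented_surface O.
Local Notation K := (complex_of O).

Lemma os_neq a b c : O a b c -> [/\ a != b, b != c & c != a].
Proof.
have neq x y z : O x y z -> x != y.
  by move=> xyz; apply/eqP => xy; move: (os_asym surfO xyz); rewrite -xy in xyz *;
    rewrite xyz.
move=> abc; have bca := os_rot surfO abc.
by split; apply: neq; [exact: abc | exact: bca | exact: os_rot bca].
Qed.

Lemma complex_ofP (s : {set 'I_N}) :
  reflect (s != finset.set0 /\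
           exists a b c, O a b c /\ s \subset [set a; b; c]%SET) (s \in K).
Proof.
rewrite inE; apply: (iffP andP) => -[s0].
  by case/existsP => -[[a b] c] /andP[/= abc sabc]; split => //; exists a, b, c.
case=> a [b] [c] [abc sabc]; split => //; apply/existsP; exists (a, b, c).
by rewrite /= abc.
Qed.

Lemma complex_of_star (s : {set 'I_N}) x : s \in K -> x \in s ->
  exists b c, O x b c /\ s \subset [set x; b; c]%SET.
Proof.
case/complex_ofP => _ [a] [b] [c] [abc sabc] /(fintype.subsetP sabc).
have bca := os_rot surfO abc; have cab := os_rot surfO bca.
rewrite !inE => /orP[/orP[]|] /eqP ->.
- by exists b, c.
- exists c, a; split=> //; apply: (fintype.subset_trans sabc).
  by apply/fintype.subsetP => y; rewrite !inE => /orP[/orP[]|] ->; rewrite ?orbT.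
- exists a, b; split=> //; apply: (fintype.subset_trans sabc).
  by apply/fintype.subsetP => y; rewrite !inE => /orP[/orP[]|] ->; rewrite ?orbT.
Qed.

Lemma complex_of_simplicial : simplicial_complex K.
Proof.
split; first by rewrite inE eqxx.
move=> s t /complex_ofP[_ [a] [b] [c] [abc sabc]] ts t0.
by apply/complex_ofP; split=> //; exists a, b, c; split=> //;
  apply: fintype.subset_trans sabc.
Qed.

Lemma cards3_uniq (T : finType) (a b c : T) : a != b -> b != c -> c != a ->
  #|[set a; b; c]%SET| = 3%N.
Proof.
move=> ab bc ca; rewrite finset.setUC cardsU1 cards2 ab !inE negb_or ca.
by rewrite eq_sym bc.
Qed.

Lemma card_complex_of s : s \in K -> (#|s| <= 3)%N.
Proof.
case/complex_ofP => _ [a] [b] [c] [/os_neq[ab bc ca] /subset_leq_card].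
by rewrite cards3_uniq.
Qed.

Lemma triangle_complex_of a b c : is_triangle K a b c = O a b c || O b a c.
Proof.
apply/andP/orP => [[+ sK]|abc].
  rewrite /= !inE negb_or andbT => /andP[/andP[ab ac] bc].
  have aabc : a \in [set a; b; c]%SET by rewrite !inE eqxx.
  have [y [z [ayz /fintype.subsetP sub]]] := complex_of_star sK aabc.
  have := sub c; have := sub b; rewrite !inE !eqxx !orbT.
  rewrite [b == a]eq_sym (negPf ab) [c == a]eq_sym (negPf ac) /=.
  case/(_ isT)/orP => /eqP bE /(_ isT)/orP[]/eqP cE; move: bc; rewrite bE cE ?eqxx //.
    by move=> _; left.
  by move=> _; right; apply/(os_rot surfO)/(os_rot surfO).
wlog {abc} abc : a b / O a b c.
  move=> wl; case: abc => h; first exact: wl.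
  have [ub bK] := wl _ _ h.
  rewrite [[set a; b]%SET]finset.setUC; split=> //; move: ub.
  by rewrite /= !inE !negb_or !andbT [b == a]eq_sym => /andP[/andP[-> ->] ->].
have [ab bc ca] := os_neq abc; split.
  by rewrite /= !inE negb_or ab bc eq_sym ca.
apply/complex_ofP; split; first by apply/set0Pn; exists a; rewrite !inE eqxx.
by exists a, b, c.
Qed.

(** If the triangle found traverses the edge backwards, [os_opp] supplies the one on the other
    side. *)
Lemma edge_complex_of a b : a != b ->
  ([set a; b]%SET \in K) = [exists c, O a b c].
Proof.
move=> ab; apply/idP/existsP => [|[c abc]].
  have aab : a \in [set a; b]%SET by rewrite !inE eqxx.
  move=> sK; have [y [z [ayz /fintype.subsetP/(_ b)]]] := complex_of_star sK aab.
  rewrite !inE eqxx orbT [b == a]eq_sym (negPf ab) => /(_ isT)/orP[]/eqP bE.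
    by exists z; rewrite bE.
  by move: (os_rot surfO (os_rot surfO ayz)) => /(os_opp surfO); rewrite bE.
apply/complex_ofP; split; first by apply/set0Pn; exists a; rewrite !inE eqxx.
exists a, b, c; split=> //; apply/fintype.subsetP => y.
by rewrite !inE => /orP[] ->; rewrite ?orbT.
Qed.

Lemma vertex_complex_of a :
  ([set a]%SET \in K) = [exists b, exists c, O a b c].
Proof.
apply/idP/existsP => [|[b /existsP[c abc]]].
  have aa : a \in [set a]%SET by rewrite inE.
  move=> sK; have [b [c [abc _]]] := complex_of_star sK aa.
  by exists b; apply/existsP; exists c.
apply/complex_ofP; split; first by apply/set0Pn; exists a; rewrite inE.
by exists a, b, c; split=> //; apply/fintype.subsetP => y; rewrite !inE => ->.
Qed.

(** By [os_fun] two different triangles on an edge cannot both traverse it in the same direction. *)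
Lemma orientable_complex_of : orientable K.
Proof.
exists O; split=> [a b c|a b c d].
  rewrite triangle_complex_of => /orP[] abc.
    by rewrite (os_rot surfO abc) (negPf (os_asym surfO abc)) abc.
  rewrite abc; have /negbTE aO := os_asym surfO abc; rewrite aO; split=> //.
  apply/negbTE/negP => bca; move: aO.
  by rewrite (os_rot surfO (os_rot surfO bca)).
rewrite !triangle_complex_of => abc abd /eqP cd.
apply/idP/idP => [Od|].
  by apply/negP => Oc; apply: cd; exact: os_fun Oc Od.
move: abc => /orP[->//|bac] nabc; case/orP: abd => // bad.
by case: cd; exact: os_fun bac bad.
Qed.

Lemma card_fibers (T U : finType) (P : {set T}) (Q : {set U}) (h : T -> U) m :
  (forall t, t \in P -> h t \in Q) ->
  (forall u, u \in Q -> #|[set t in P | h t == u]%SET| = m) ->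
  #|P| = (#|Q| * m)%N.
Proof.
move=> hPQ hm; rewrite -sum1_card (partition_big h (mem Q)) //= -sum_nat_const.
apply: eq_bigr => u uQ; rewrite -(hm u uQ) -sum1_card; apply: eq_bigl => t.
by rewrite !inE.
Qed.

(** Each edge starts two oriented triples, one per direction, and each triangle is read as three
    cyclic triples. So the number of triples is 2E and also 3F, and F - E is minus one sixth of
    it. *)
Lemma euler_complex_of :
  6 * euler_characteristic K =
  6 * #|[set a | [exists b, exists c, O a b c]]%SET|%:Z -
  #|[set t : 'I_N * 'I_N * 'I_N | O t.1.1 t.1.2 t.2]%SET|%:Z.
Proof.
set U := finset _; set T := finset (fun t : _ * _ * _ => _).
pose K_ i := [set s in K | #|s| == i]%SET.
have chiE : euler_characteristic K = #|K_ 1%N|%:Z - #|K_ 2%N|%:Z + #|K_ 3%N|%:Z.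
  rewrite /euler_characteristic.
  have sumK_ i : \sum_(s in K_ i) (-1) ^+ #|s|.-1 = (-1) ^+ i.-1 *+ #|K_ i| :> int.
    rewrite -sumr_const; apply: eq_bigr => s.
    by rewrite inE => /andP[_ /eqP ->].
  have KE : K = K_ 1%N :|: (K_ 2%N :|: K_ 3%N).
    apply/setP => s; rewrite !inE -!andb_orr; case: (boolP (_ && _)) => //= sK.
    have s3 : (#|s| <= 3)%N by apply: card_complex_of; rewrite inE.
    have s0 : (0 < #|s|)%N by rewrite card_gt0; case/andP: sK.
    by case: #|s| s3 s0 => [|[|[|[|]]]].
  have disjK i j : i != j -> [disjoint K_ i & K_ j].
    move=> ij; rewrite -setI_eq0; apply/eqP/setP => s; rewrite !inE.
    by apply/negP => /andP[/andP[_ /eqP ->] /andP[_]]; exact/negP.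
  have -> : \sum_(s in K) (-1) ^+ #|s|.-1 =
      \sum_(s in [predU K_ 1%N & [predU K_ 2%N & K_ 3%N]]) (-1) ^+ #|s|.-1 :> int.
    by apply: eq_bigl => s; rewrite {1}KE !finset.in_setU.
  rewrite bigU /=; last first.
    by rewrite disjoint_sym disjointU ![[disjoint _ & K_ 1%N]]disjoint_sym !disjK.
  rewrite bigU ?disjK //= !sumK_ /= expr0 expr1 sqrrN expr1n.
  by rewrite mulNrn !natz addrA.
have K1 : #|K_ 1%N| = #|U|.
  rewrite -(card_imset (mem U) set1_inj); apply/eq_card => s.
  apply/idP/imsetP => [|[a aU ->]].
    rewrite inE => /andP[sK /cards1P[a sE]]; exists a => //.
    by rewrite inE -vertex_complex_of -sE.
  by rewrite inE cards1 eqxx andbT vertex_complex_of; rewrite !inE in aU *.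
have TK2 : #|T| = (#|K_ 2%N| * 2)%N.
  apply: (card_fibers (h := fun t => [set t.1.1; t.1.2]%SET)) => [[[a b] c]|s sQ].
    rewrite inE /= => abc; have [ab _ _] := os_neq abc.
    by rewrite inE cards2 ab edge_complex_of // andbT; apply/existsP; exists c.
  move: sQ; rewrite inE => /andP[sK /cards2P[a [b [ab sE]]]].
  move: sK; rewrite sE edge_complex_of // => /existsP[c abc].
  have [d bad] := os_opp surfO abc.
  have -> : finset (fun t => (t \in T) && ([set t.1.1; t.1.2]%SET == [set a; b]%SET)) =
            [set (a, b, c); (b, a, d)]%SET.
    apply/setP => -[[x y] z]; rewrite !inE /=.
    apply/andP/orP => [[xyz /eqP/setP xyab]|[]/eqP[-> -> ->] //].
      have [xy _ _] := os_neq xyz.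
      move: (xyab x) (xyab y); rewrite !inE !eqxx orbT.
      case/esym/orP => /eqP xE /esym/orP[]/eqP yE; move: xy xyz;
        rewrite xE yE ?eqxx // => _ Oz.
        by left; rewrite (os_fun surfO Oz abc).
      by right; rewrite (os_fun surfO Oz bad).
    by split => //; rewrite finset.setUC.
  by rewrite cards2 !xpair_eqE (negPf ab).
have TK3 : #|T| = (#|K_ 3%N| * 3)%N.
  apply: (card_fibers (h := fun t => [set t.1.1; t.1.2; t.2]%SET)) => [[[a b] c]|s sQ].
    rewrite inE /= => abc; have [ab bc ca] := os_neq abc.
    rewrite inE cards3_uniq // andbT; apply/complex_ofP; split.
      by apply/set0Pn; exists a; rewrite !inE eqxx.
    by exists a, b, c.
  move: sQ; rewrite inE => /andP[/complex_ofP[_ [a] [b] [c] [abc sabc]] s3].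
  have [ab bc ca] := os_neq abc.
  have {sabc s3} -> : s = [set a; b; c]%SET.
    by apply/eqP; rewrite eqEcard sabc cards3_uniq // (eqP s3).
  have bca := os_rot surfO abc; have cab := os_rot surfO bca.
  have -> : finset (fun t => (t \in T) &&
                ([set t.1.1; t.1.2; t.2]%SET == [set a; b; c]%SET)) =
            [set (a, b, c); (b, c, a); (c, a, b)]%SET.
    apply/setP => -[[x y] z]; rewrite !inE /=.
    apply/andP/orP => [[xyz /eqP/setP xyab]|]; last first.
      case=> [/orP[]|] /eqP[-> -> ->]; split => //; apply/eqP/setP => w;
        rewrite !inE; do ![case: eqP => ? //=].
    (* The triangle across an edge has its third vertex off the given triangle; this rules out the
       three anticyclic readings. *)
    have excl u v w t : O u v w -> O v u t ->
        t \notin [set u; v; w]%SET.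
      move=> uvw vut; have [_ ut tv] := os_neq vut.
      rewrite !inE !negb_or [t == u]eq_sym ut tv /=; apply/eqP => tw.
      by have := os_asym surfO uvw; rewrite -tw vut.
    have [xy _ _] := os_neq xyz.
    have zabc : z \in [set a; b; c]%SET by rewrite -xyab !inE eqxx orbT.
    have zbca : z \in [set b; c; a]%SET.
      by move: zabc; rewrite !inE; case: (z == a); case: (z == b); case: (z == c).
    have zcab : z \in [set c; a; b]%SET.
      by move: zabc; rewrite !inE; case: (z == a); case: (z == b); case: (z == c).
    move: (xyab x) (xyab y); rewrite !inE !eqxx !orbT.
    move=> /esym/orP[/orP[]|] /eqP xE /esym/orP[/orP[]|] /eqP yE; move: xyz xy;
      rewrite xE yE ?eqxx // => Oz _.
    - by left; rewrite (os_fun surfO Oz abc) eqxx.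
    - by have := excl _ _ _ _ cab Oz; rewrite zcab.
    - by have := excl _ _ _ _ abc Oz; rewrite zabc.
    - by left; rewrite (os_fun surfO Oz bca) eqxx orbT.
    - by right; rewrite (os_fun surfO Oz cab) eqxx.
    - by have := excl _ _ _ _ bca Oz; rewrite zbca.
  rewrite cards3_uniq // !xpair_eqE.
  - by rewrite (negPf ab).
  - by rewrite (negPf bc).
  - by rewrite (negPf ca).
rewrite chiE K1; lia.
Qed.

End Complex.

(** * Rotation systems *)

(** The left factor acts first: cross the edge, then turn back one step about the new tail. The
    cycles are the face walks. *)
Definition face_perm (D : finType) (nd ed : {perm D}) : {perm D} := (ed * nd^-1)%g.

(* nd turns a dart about its tail and ed reverses it.  Faces of length 1 and 2
   are excluded by the other conditions, those of length 3 by rs_face. *)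
Record rotation_system (V D : finType) (tl : D -> V) (nd ed : {perm D}) : Prop := {
  rs_edK : involutive ed;
  rs_tail : forall v, exists d, tl d = v;
  rs_orbit : forall d d', (tl d == tl d') = (d' \in porbit nd d);
  rs_simple : forall d d', tl d = tl d' -> tl (ed d) = tl (ed d') -> d = d';
  rs_loopless : forall d, tl (ed d) != tl d;
  rs_deg : forall d, nd d != d;
  rs_face : forall d,
    face_perm nd ed (face_perm nd ed (face_perm nd ed d)) != d;
  rs_connected : forall u v,
    connect (fun x y => [exists d, (tl d == x) && (tl (ed d) == y)]) u v }.

(* The triangulation has the vertices of the graph, one vertex for each dart d
   (drawn next to the left side of d) and one for each face.  Its triangles are
   (tail d, head d, d), (tail (fc x), fc x, x) and (face of x, x, fc x). *)
Definition map_triangle (V D : finType) (tl : D -> V) (nd ed : {perm D})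
    (a b c : V + D + {set D}) : bool :=
  let fc := face_perm nd ed in
  match a, b, c with
  | inl (inl u), inl (inl v), inl (inr d)
  | inl (inr d), inl (inl u), inl (inl v)
  | inl (inl v), inl (inr d), inl (inl u) => (tl d == u) && (tl (ed d) == v)
  | inl (inl v), inl (inr d), inl (inr x)
  | inl (inr d), inl (inr x), inl (inl v)
  | inl (inr x), inl (inl v), inl (inr d) => (d == fc x) && (tl d == v)
  | inr z, inl (inr x), inl (inr d)
  | inl (inr x), inl (inr d), inr z
  | inl (inr d), inr z, inl (inr x) => (d == fc x) && (z == porbit fc x)
  | _, _, _ => false
  end.

(** * Triangulating the surface of a rotation system *)

Section Triangulation.
Variables (V D : finType) (tl : D -> V) (nd ed : {perm D}).
Hypothesis rs : rotation_system tl nd ed.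
Local Notation fc := (face_perm nd ed).
Local Notation tri := (map_triangle tl nd ed).
Local Notation W := (V + D + {set D})%type.

Let fcE d : fc d = (nd^-1)%g (ed d). Proof. by rewrite /face_perm permM. Qed.

Let edK := rs_edK rs.

Lemma tl_nd d : tl (nd d) = tl d.
Proof. by apply/esym/eqP; rewrite (rs_orbit rs) (mem_porbit nd 1 d). Qed.

Lemma tl_fc d : tl (fc d) = tl (ed d).
Proof. by rewrite -[in RHS](permKV nd (ed d)) -fcE tl_nd. Qed.

Lemma fc_ed_nd d : fc (ed (nd d)) = d.
Proof. by rewrite fcE edK permK. Qed.

(** On a digon [fc d] and [ed d] would have the same ends, hence coincide by simplicity, and [nd]
    would fix a dart. *)
Let fc2_neq d : fc (fc d) != d.
Proof.
apply: contraNneq (rs_deg rs (fc d)) => E.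
have fed : fc d = ed d.
  by apply: (rs_simple rs); [exact: tl_fc | rewrite edK -tl_fc E].
by rewrite {1}fcE permKV -fed.
Qed.

Let porbit_fc d : porbit fc (fc d) = porbit fc d.
Proof. by apply/eqP; rewrite eq_porbit_mem (mem_porbit fc 1 d). Qed.

Let porbit_fcV d : porbit fc ((fc^-1)%g d) = porbit fc d.
Proof. by rewrite -[in RHS](permKV fc d) porbit_fc. Qed.

Lemma map_triangle_rot a b c : tri a b c -> tri b c a.
Proof. by case: a b c => [[u|d]|z] [[v|x]|y] [[w|t]|r]. Qed.

(** Apart from the injectivity of [fc], two candidates for the third vertex would exhibit a loop, a
    digon or two parallel edges. *)
Lemma map_triangle_fun a b c d : tri a b c -> tri a b d -> c = d.
Proof.
case: a b c d => [[u|d]|z] [[v|x]|y] [[w|t]|r] [[w'|t']|r'] //=.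
all: try by move=> /andP[/eqP <- /eqP <-] /andP[/eqP // _ /eqP <-].
all: move=> /andP[/eqP h1 /eqP h2] /andP[/eqP h3 /eqP h4]; try by congruence.
- by congr (inl (inr _)); apply: (rs_simple rs); rewrite ?h1 ?h2 ?h3 ?h4.
- by case/eqP: (rs_loopless rs x); rewrite h2 h4.
- by case/eqP: (rs_loopless rs x); rewrite h2 h4.
- by congr (inl (inr _)); apply: (@perm_inj _ fc); rewrite -h1 -h3.
- by case/eqP: (rs_loopless rs d); rewrite -tl_fc -h3 h4.
- by case/eqP: (rs_loopless rs d); rewrite -tl_fc -h1 h2.
- by case/eqP: (fc2_neq x); rewrite -h1 -h3.
- by case/eqP: (fc2_neq d); rewrite -h1 -h3.
- by congr (inl (inr _)); apply: (@perm_inj _ fc); rewrite -h1 -h3.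
Qed.

Lemma map_triangle_opp a b c : tri a b c -> exists d, tri b a d.
Proof.
case: a b c => [[u|d]|z] [[v|x]|y] [[w|t]|r] //= /andP[/eqP h1 /eqP h2].
- by exists (inl (inr (ed t))) => /=; rewrite edK h1 h2 !eqxx.
- by exists (inl (inr (fc x))) => /=; rewrite tl_fc h2 !eqxx.
- by exists (inl (inl (tl (ed x)))) => /=; rewrite h2 !eqxx.
- by exists (inl (inr ((fc^-1)%g d))) => /=; rewrite permKV h1 !eqxx.
- by exists (inl (inl (tl d))) => /=; rewrite -h2 h1 tl_fc !eqxx.
- by exists (inr (porbit fc x)) => /=; rewrite h1 !eqxx.
- by exists (inl (inl (tl x))) => /=; rewrite h1 !eqxx.
- by exists (inl (inr (fc d))) => /=; rewrite h2 h1 porbit_fc !eqxx.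
- by exists (inl (inr ((fc^-1)%g x))) => /=; rewrite permKV porbit_fcV h2 !eqxx.
Qed.

Let tl_absurd d u : tl d = u -> tl (ed d) = u -> False.
Proof. by move=> <-; apply/eqP/(rs_loopless rs). Qed.

Let fc2_absurd x y : x = fc y -> y = fc x -> False.
Proof. by move=> xE yE; case/eqP: (fc2_neq y); rewrite -xE -yE. Qed.

Lemma map_triangle_asym a b c : tri a b c -> ~~ tri b a c.
Proof.
case: a b c => [[u|d]|z] [[v|x]|y] [[w|t]|r] //= /andP[/eqP h1 /eqP h2];
  apply/negP => /andP[/eqP h3 /eqP h4];
  first [exact: (fc2_absurd h1 h3) | by apply: (tl_absurd h1); congruence].
Qed.

(** The link has length 3d at a graph vertex of degree d, 5 at a dart vertex, and the length of the
    face at a face vertex. So [rs_deg] and [rs_face] are what keeps it from being 3. *)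
Lemma map_triangle_link_ge4 v a b c : tri v a b -> tri v b c -> ~~ tri v c a.
Proof.
have tlfc := tl_fc.
have deg1 x t : x = fc t -> tl (ed x) = tl t -> False.
  move=> xE edx; have xt : x = ed t.
    by apply: (rs_simple rs); rewrite ?edK // xE tl_fc.
  by case/eqP: (rs_deg rs x); rewrite {1}xE fcE permKV.
have face3 x y t : x = fc y -> y = fc t -> t = fc x -> False.
  by move=> xE yE tE; case/eqP: (rs_face rs t); rewrite -yE -xE -tE.
case: v a b c => [[u0|d0]|z0] [[u|d]|z] [[v|x]|y] [[w|t]|r] //=;
  move=> /andP[/eqP h1 /eqP h2] /andP[/eqP h3 /eqP h4];
  apply/negP => /andP[/eqP h5 /eqP h6];
  first [exact: (fc2_absurd h1 h3) | exact: (fc2_absurd h3 h5)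
    | exact: (fc2_absurd h5 h1) | exact: (face3 _ _ _ h1 h5 h3)
    | by apply: (deg1 _ _ h1); congruence | by apply: (deg1 _ _ h3); congruence
    | by apply: (deg1 _ _ h5); congruence
    | by apply: (tl_absurd h1); congruence].
Qed.

(** At a graph vertex, turning from one dart to the next takes three steps in the link. Since the
    relation is directed, [out] leads from a link vertex to the head of some dart and [inn] leads
    back from such a head. *)
Lemma map_triangle_link v a b c d : tri v a b -> tri v c d ->
  connect (tri v) a c.
Proof.
have step x y : tri v x y -> connect (tri v) x y by exact: connect1.
case: v step => [[u|x]|z] step.
- have turn d0 : tl d0 = u -> connect (tri (inl (inl u)))
      (inl (inl (tl (ed d0)))) (inl (inl (tl (ed (nd d0))))).
    move=> du; apply: (@connect_trans _ _ (inl (inr d0))).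
      by apply: step; rewrite /= du !eqxx.
    apply: (@connect_trans _ _ (inl (inr (ed (nd d0))))).
      by apply: step; rewrite /= fc_ed_nd du !eqxx.
    by apply: step; rewrite /= edK tl_nd du !eqxx.
  have around d1 d2 : tl d1 = u -> tl d2 = u -> connect (tri (inl (inl u)))
      (inl (inl (tl (ed d1)))) (inl (inl (tl (ed d2)))).
    move=> d1u d2u; have /porbitP[i ->] : d2 \in porbit nd d1.
      by rewrite -(rs_orbit rs) d1u d2u.
    elim: i => [|i IHi]; first by rewrite expg0 perm1.
    rewrite expgSr permM; apply: connect_trans IHi (turn _ _).
    by rewrite -d1u; apply/eqP; rewrite eq_sym (rs_orbit rs) mem_porbit.
  have out a' b' : tri (inl (inl u)) a' b' -> exists2 d0, tl d0 = u &
      connect (tri (inl (inl u))) a' (inl (inl (tl (ed d0)))).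
    case: a' b' => [[w|x]|z] [[w'|x']|z'] //= /andP[/eqP h1 /eqP h2].
    - by exists x'; rewrite ?h2.
    - exists (ed x); first by [].
      by rewrite edK; apply: step; rewrite /= h2 !eqxx.
    - exists (nd x); first by rewrite tl_nd.
      have nx : ed (nd x) = x' by rewrite h1 fcE permKV edK.
      apply: (@connect_trans _ _ (inl (inr x'))); apply: step.
        by rewrite /= {1}h1 h2 !eqxx.
      by rewrite nx /= -tl_fc -h1 h2 !eqxx.
  have inn a' b' : tri (inl (inl u)) a' b' -> exists2 d0, tl d0 = u &
      connect (tri (inl (inl u))) (inl (inl (tl (ed d0)))) a'.
    case: a' b' => [[w|x]|z] [[w'|x']|z'] //= /andP[/eqP h1 /eqP h2].
    - by exists x'; rewrite ?h2.
    - pose y := (nd^-1)%g (ed x).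
      have xE : x = ed (nd y) by rewrite /y permKV edK.
      have yu : tl y = u by rewrite -tl_nd /y permKV.
      exists y => //; apply: (@connect_trans _ _ (inl (inr y))); apply: step.
        by rewrite /= yu !eqxx.
      by rewrite /= xE fc_ed_nd yu !eqxx.
    - by exists x => //; apply: step; rewrite /= h2 !eqxx.
  move=> /out[d1 d1u ad1] /inn[d2 d2u cd2].
  exact: connect_trans ad1 (connect_trans (around _ _ d1u d2u) cd2).
- pose p : seq W := [:: inl (inl (tl x)); inl (inl (tl (ed x))); inl (inr (fc x));
                        inr (porbit fc x); inl (inr ((fc^-1)%g x))].
  have cp : path.cycle (tri (inl (inr x))) p.
    by rewrite /= !tl_fc !permKV porbit_fcV !eqxx.
  have link a' b' : tri (inl (inr x)) a' b' -> a' \in p.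
    case: a' b' => [[w|y]|z] [[w'|y']|z'] //= /andP[/eqP h1 /eqP h2]; rewrite !inE.
    - by rewrite -h1 eqxx.
    - by rewrite -h2 h1 tl_fc eqxx orbT.
    - by rewrite h1 permK eqxx !orbT.
    - by rewrite h1 eqxx !orbT.
    - by rewrite h2 h1 porbit_fc eqxx !orbT.
  by move=> /link ap /link cp'; exact: (connect_cycle cp).
- case: a b c d => [[w|y]|z0] [[w'|y']|z'] [[w1|y1]|z1] [[w1'|y1']|z1'] //=.
  move=> /andP[/eqP _ /eqP h1] /andP[_ /eqP h2].
  have /porbitP[i ->] : y1 \in porbit fc y by rewrite -h1 h2 porbit_id.
  elim: i => [|i IHi]; first by rewrite expg0 perm1.
  apply: connect_trans IHi (step _ _ _); rewrite expgSr permM /= eqxx h1 /=.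
  by rewrite eq_sym eq_porbit_mem mem_porbit.
Qed.

Lemma map_triangle_conn a b c a' b' c' : tri a b c -> tri a' b' c' ->
  connect (fun x y => [exists z, tri x y z]) a a'.
Proof.
set e := fun _ _ => _; have e_sym : symmetric e.
  by move=> x y; apply/existsP/existsP => -[z]; exact: map_triangle_opp.
have vv u v : connect e (inl (inl u)) (inl (inl v)).
  have /connectP[p + ->] := rs_connected rs u v.
  elim: p u => [|w p IHp] u //= /andP[/existsP[d /andP[/eqP du /eqP dw]] wp].
  apply: connect_trans (IHp _ wp); apply: connect1; apply/existsP.
  by exists (inl (inr d)); rewrite /= du dw !eqxx.
have tov x y z : tri x y z -> exists v, connect e x (inl (inl v)).
  have dv d : connect e (inl (inr d)) (inl (inl (tl d))).
    apply: connect1; apply/existsP; exists (inl (inl (tl (ed d)))).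
    by rewrite /= !eqxx.
  case: x y z => [[u|d]|z0] [[v|y]|z1] [[w|t]|z2] //= h; try by [exists u]; try by exists (tl d).
  exists (tl y); apply: connect_trans (dv _); apply: connect1; apply/existsP.
  by exists (inl (inr t)).
move=> /tov[v av] /tov[v' a'v']; apply: connect_trans av (connect_trans (vv _ v') _).
by rewrite (sym_connect_sym e_sym).
Qed.

Lemma map_triangle_surface : oriented_surface tri.
Proof.
split; [exact: map_triangle_rot | exact: map_triangle_fun | exact: map_triangle_opp
  | exact: map_triangle_asym | exact: map_triangle_link | exact: map_triangle_link_ge4
  | exact: map_triangle_conn].
Qed.


End Triangulation.

(** * Euler's inequality *)

Lemma mem_porbits_perm (D : finType) (s : {perm D}) (z : {set D}) d :
  z \in porbits s -> (s d \in z) = (d \in z).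
Proof.
case/imsetP => x _ ->; rewrite -!eq_porbit_mem.
by congr (_ == _); apply/eqP; rewrite eq_porbit_mem (mem_porbit s 1 d).
Qed.

Lemma porbits_mem (D : finType) (s : {perm D}) (z : {set D}) d :
  z \in porbits s -> d \in z -> z = porbit s d.
Proof.
by case/imsetP => x _ ->; rewrite -eq_porbit_mem => /eqP.
Qed.

Definition porbits_mx (D : finType) (s : {perm D}) : 'M[rat]_(#|porbits s|, #|D|) :=
  \matrix_(i, j) ((enum_val j : D) \in (enum_val i : {set D}))%:R.

Lemma mul_porbits_mx (D : finType) (s : {perm D}) (u : 'rV_#|porbits s|) d i :
  d \in (enum_val i : {set D}) -> (u *m porbits_mx s) ord0 (enum_rank d) = u ord0 i.
Proof.
move=> di; rewrite mxE (bigD1 i) //= mxE enum_rankK di mulr1 big1 ?addr0 // => j ji.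
rewrite mxE enum_rankK; case: (boolP (d \in _)) => [dj|_]; last by rewrite mulr0.
case/eqP: ji; apply: enum_val_inj.
by rewrite (porbits_mem (enum_valP i) di) (porbits_mem (enum_valP j) dj).
Qed.

Section EulerGenus.
Variables (V D : finType) (tl : D -> V) (nd ed : {perm D}).
Hypothesis rs : rotation_system tl nd ed.
Local Notation fc := (face_perm nd ed).

(** Connectedness of the graph in terms of darts: [nd] and [ed] act transitively. *)
Lemma dart_const (T : Type) (f : D -> T) :
  (forall d, f (nd d) = f d) -> (forall d, f (ed d) = f d) ->
  forall d d', f d = f d'.
Proof.
move=> fnd fed.
have fV d d' : tl d = tl d' -> f d = f d'.
  move=> /eqP; rewrite (rs_orbit rs) => /porbitP[i ->].
  elim: i => [|i IHi]; first by rewrite expg0 perm1.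
  by rewrite expgSr permM fnd.
move=> d d'; have /connectP[p + dE] := rs_connected rs (tl d) (tl d').
elim: p d dE => [|v p IHp] d /= dE; first by move=> _; exact: fV.
case/andP => /existsP[x /andP[/eqP xd /eqP xv]] vp.
rewrite -(fV x d xd) -fed; apply: IHp; by rewrite xv.
Qed.

Lemma card_porbits_node : #|porbits nd| = #|V|.
Proof.
pose star v := finset (fun d => tl d == v).
have star_inj : injective star.
  move=> u v /setP uv; have [d du] := rs_tail rs u.
  by have := uv d; rewrite !inE du eqxx => /esym/eqP.
rewrite -cardsT -(card_imset _ star_inj); apply/eq_card => z.
have starE d : porbit nd d = star (tl d).
  by apply/setP => d'; rewrite inE -(rs_orbit rs) eq_sym.
apply/imsetP/imsetP => [[d _ ->]|[v _ ->]]; first by exists (tl d).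
by have [d <-] := rs_tail rs v; exists d.
Qed.

Lemma card_porbits_edge : #|D| = (#|porbits ed| * 2)%N.
Proof.
rewrite -cardsT; apply: (card_fibers (h := porbit ed)) => [d _|z /imsetP[d _ ->]].
  exact: imset_f.
have -> : finset (fun t => (t \in [set: D]%SET) && (porbit ed t == porbit ed d)) =
          [set d; ed d]%SET.
  apply/setP => x; rewrite !inE eq_porbit_mem /=; apply/idP/orP.
    case/porbitP => i ->; elim: i => [|i IHi]; first by rewrite expg0 perm1 eqxx; left.
    rewrite expgSr permM; case: IHi => /eqP ->; first by right; rewrite eqxx.
    by left; rewrite (rs_edK rs) eqxx.
  case=> /eqP ->; first exact: porbit_id.
  by have := mem_porbit ed 1 d; rewrite expg1.
by rewrite cards2; case: eqP => // dE; have := rs_loopless rs d; rewrite -dE eqxx.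
Qed.

(** The sign of a permutation is the parity of the number of points plus the number of cycles; it is
    multiplicative on [ed * nd^-1], and the number of darts is even. *)
Lemma odd_euler : odd (#|V| + #|porbits fc| + #|porbits ed|) = false.
Proof.
have := odd_permM ed (nd^-1)%g; rewrite odd_permV /odd_perm card_porbits_node.
rewrite card_porbits_edge oddM andbF /= -/(face_perm nd ed) => E.
by rewrite !oddD E; case: (odd #|V|); case: (odd #|porbits ed|).
Qed.

(* The coboundaries of functions on vertices are orthogonal to the incidence
   vectors of faces and edges; both families have corank at most one since the
   graph is connected. *)
Lemma euler_le : (#|V| + #|porbits fc| <= #|porbits ed| + 2)%N.
Proof.
pose A : 'M[rat]_(#|V|, #|D|) := \matrix_(i, j)
  ((tl (enum_val j) == enum_val i)%:R - (tl (ed (enum_val j)) == enum_val i)%:R).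
(* A row of [A] summed over a cycle of [s] telescopes. Both [fc] and [ed] take a dart to one that
   starts at its head, so this covers faces and edges. *)
have orth (s : {perm D}) : (forall d, tl (s d) = tl (ed d)) -> A *m (porbits_mx s)^T = 0.
  move=> sE; apply/matrixP => i k; rewrite !mxE.
  have inv d := mem_porbits_perm d (enum_valP k).
  pose G d : rat := (tl d == enum_val i)%:R * (d \in (enum_val k : {set D}))%:R.
  have enumE (H : D -> rat) : \sum_(j < #|D|) H (enum_val j) = \sum_d H d.
    by rewrite [RHS](reindex _ (onW_bij _ (enum_val_bij D))).
  transitivity (\sum_(j < #|D|) (G (enum_val j) - G (s (enum_val j)))).
    by apply: eq_bigr => j _; rewrite !mxE mulrBl /G sE inv.
  rewrite (enumE (fun d => G d - G (s d))) sumrB.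
  by rewrite (reindex_inj (@perm_inj _ s)) subrr.
pose C := col_mx (porbits_mx fc) (porbits_mx ed).
have AC : A *m C^T = 0.
  by rewrite tr_col_mx mul_mx_row !orth ?row_mx0 // => d; rewrite ?(tl_fc rs).
(* Corank at most one is shown by placing the left kernel inside a line. *)
have rank_line m n (M : 'M[rat]_(m, n)) (w : 'rV[rat]_m) :
    (forall u : 'rV_m, u *m M = 0 -> exists a, u = a *: w) -> (m <= \rank M + 1)%N.
  move=> line; have : (\rank (kermx M) <= 1)%N.
    apply: leq_trans (rank_leq_row w); apply: mxrankS; apply/row_subP => i.
    have [a ->] : exists a, row i (kermx M) = a *: w.
      by apply: line; rewrite -row_mul mulmx_ker row0.
    by rewrite scalemx_sub.
  by rewrite mxrank_ker leq_subLR.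
have rkA : (#|V| <= \rank A + 1)%N.
  apply: (rank_line _ _ _ (const_mx 1)) => u uA.
  pose f d := u ord0 (enum_rank (tl d)).
  have fed d : f (ed d) = f d.
    have /rowP/(_ (enum_rank d)) := uA; rewrite !mxE.
    under eq_bigr do rewrite mxE enum_rankK mulrBr.
    rewrite sumrB (bigD1 (enum_rank (tl d))) //= enum_rankK eqxx mulr1.
    rewrite big1 => [|i]; last first.
      by apply: contraNeq => /eqP; case: eqP => [->|_]; rewrite ?enum_valK ?mulr0.
    rewrite (bigD1 (enum_rank (tl (ed d)))) //= enum_rankK eqxx mulr1.
    rewrite big1 => [|i]; last first.
      by apply: contraNeq => /eqP; case: eqP => [->|_]; rewrite ?enum_valK ?mulr0.
    by rewrite !addr0 => /eqP; rewrite subr_eq0 => /eqP.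
  have [i|nV] := pickP 'I_#|V|; last by exists 0; apply/rowP => i; have := nV i.
  have [d0 d0i] := rs_tail rs (enum_val i).
  exists (f d0); apply/rowP => j; rewrite !mxE mulr1.
  have [d dj] := rs_tail rs (enum_val j).
  have := dart_const (f := f) _ fed d d0; rewrite /f dj enum_valK => -> //.
  by move=> d'; rewrite /f (tl_nd rs).
have rkC : (#|porbits fc| + #|porbits ed| <= \rank C + 1)%N.
  apply: (rank_line _ _ _ (row_mx (const_mx 1) (const_mx (-1)))) => u.
  rewrite -(hsubmxK u) mul_row_col; set u1 := lsubmx u; set u2 := rsubmx u => uC.
  (* In a linear relation among the rows of [C], the weight of the face through a dart is minus the
     weight of its edge. Connectedness makes both constant, so the kernel is spanned by 1 on faces
     and -1 on edges. *)
  have zero d i j : d \in (enum_val i : {set D}) -> d \in (enum_val j : {set D}) -> u1 ord0 i = - u2 ord0 j.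
    move=> di dj; have /rowP/(_ (enum_rank d)) := uC.
    rewrite mxE [RHS]mxE (mul_porbits_mx u1 di) (mul_porbits_mx u2 dj).
    by move/eqP; rewrite addr_eq0 => /eqP.
  have porbit_ex s d : exists i : 'I_#|porbits s|, d \in (enum_val i : {set D}).
    have sd : porbit s d \in porbits s by exact: imset_f.
    by exists (enum_rank_in sd (porbit s d)); rewrite enum_rankK_in // porbit_id.
  have ex_dart s (i : 'I_#|porbits s|) : exists d, d \in (enum_val i : {set D}).
    by have /imsetP[d _ ->] := enum_valP i; exists d; exact: porbit_id.
  pose i_ d := xchoose (porbit_ex fc d); pose j_ d := xchoose (porbit_ex ed d).
  have iP d : d \in (enum_val (i_ d) : {set D}) := xchooseP (porbit_ex fc d).
  have jP d : d \in (enum_val (j_ d) : {set D}) := xchooseP (porbit_ex ed d).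
  pose f d := u1 ord0 (i_ d).
  have fed d : f (ed d) = f d.
    rewrite /f (zero (ed d) _ (j_ d)) // -?(zero d (i_ d)) //.
    by rewrite mem_porbits_perm // enum_valP.
  have fnd d : f (nd d) = f d.
    rewrite -fed /f -[in RHS](fc_ed_nd rs d) (zero _ _ _ (iP _) (jP (ed (nd d)))).
    pose x := ed (nd d).
    have xi : fc x \in (enum_val (i_ x) : {set D}).
      by rewrite mem_porbits_perm // enum_valP.
    by rewrite -(zero _ _ _ (iP x) (jP x)) (zero _ _ _ xi (jP (fc x)))
      -(zero _ _ _ (iP (fc x)) (jP (fc x))).
  have fE := dart_const fnd fed.
  have [d0 _|nD] := pickP D; last first.
    have noI (s : {perm D}) : #|porbits s| = 0%N.
      by apply/eqP; rewrite -leqn0 leqNgt; apply/negP => /card_gt0P[z /imsetP[d]]; have := nD d.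
    by exists 0; apply/rowP => -[i lti]; exfalso; rewrite !noI in lti.
  exists (f d0); rewrite scale_row_mx; congr row_mx; apply/rowP => i;
    rewrite [RHS]mxE [X in _ * X]mxE.
    have [d di] := ex_dart _ i.
    by rewrite mulr1 (zero _ _ _ di (jP d)) -(zero _ _ _ (iP d) (jP d)) -/(f d); exact: fE.
  have [d di] := ex_dart _ i.
  by rewrite mulrN1 (fE d0 d) /f (zero _ _ _ (iP d) di) opprK.
(* Orthogonality bounds the sum of the ranks by 2E, whence (V - 1) + (F + E - 1) <= 2E. *)
have rkAC := mulmx0_rank_max AC; rewrite mxrank_tr in rkAC.
move: rkA rkC rkAC card_porbits_edge.
by move: (\rank A) (\rank C) => r r'; lia.
Qed.

(** The equation is V - E + F = 2 - 2g doubled, with 2E darts. The rank inequality makes its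
    solution nonnegative and the parity makes it an integer. *)
Lemma rotation_system_genus : (0 < #|V|)%N ->
  exists g, (2 * (#|V| + #|porbits fc|) + 4 * g = #|D| + 4)%N.
Proof.
move=> V0; have le := euler_le; have ev := odd_euler.
exists ((#|porbits ed| + 2 - (#|V| + #|porbits fc|))./2).
rewrite card_porbits_edge.
have : odd (#|porbits ed| + 2 - (#|V| + #|porbits fc|)) = false.
  by rewrite oddB // oddD addbF -oddD addnC.
lia.
Qed.

End EulerGenus.

Local Open Scope classical_set_scope.
Local Open Scope ring_scope.

(** * Polyhedra *)

Lemma continuous_rV (T : topologicalType) (R : realType) (N : nat)
    (f : T -> 'rV[R]_N) :
  (forall i, continuous (fun x => f x ord0 i)) -> continuous f.
Proof.
move=> cf x A [P nP PA]; apply: (filterS PA).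
apply: filter_forall => i; apply: filter_forall => j.
by rewrite ord1; apply: cf; have := nP ord0 j.
Qed.

Lemma continuous_set_type (T S : topologicalType) (B : set S) (f : T -> B) :
  continuous (set_val \o f) -> continuous f.
Proof. exact: continuous_comp_initial. Qed.

Lemma continuous_pair (T U V : topologicalType) (f : T -> U) (g : T -> V) :
  continuous f -> continuous g -> continuous (fun x => (f x, g x)).
Proof. by move=> cf cg x; apply: cvg_pair; [exact: cf | exact: cg]. Qed.

Lemma continuous_mulr (T : topologicalType) (R : realType) (f : T -> R) (c : R) :
  continuous f -> continuous (fun x => f x * c).
Proof. by move=> cf x; apply: cvgMl; exact: cf. Qed.

Lemma continuous_sumr (T : topologicalType) (R : realType) (I : Type)
    (s : seq I) (F : I -> T -> R) :
  (forall i, continuous (F i)) -> continuous (fun x => \sum_(i <- s) F i x).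
Proof.
move=> cF x; elim: s => [|i s IHs].
  by under eq_fun do rewrite big_nil; exact: cvg_cst.
by under eq_fun do rewrite big_cons; apply: cvgD; [exact: cF | exact: IHs].
Qed.

Lemma continuous_hat (R : realType) (k i : nat) : continuous (@hat R k i).
Proof.
have ccross (p : R * R) : continuous (fun y => cross y p).
  by move=> y; apply: cvgB; apply: cvgMl; [exact: cvg_fst | exact: cvg_snd].
have cmax (f g : R * R -> R) : continuous f -> continuous g ->
    continuous (fun y => Num.max (f y) (g y)).
  by move=> cf cg y; exact: (@continuous_max R _ f g y (cf y) (cg y)).
have cmin (f g : R * R -> R) : continuous f -> continuous g ->
    continuous (fun y => Num.min (f y) (g y)).
  by move=> cf cg y; exact: (@continuous_min R _ f g y (cf y) (cg y)).
move=> y; apply: cvgMl; move: y.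
apply: cmax; first by move=> y; exact: cvg_cst.
apply: cmin; first exact: ccross.
suff -> : cross (ngon R k (i + k.-1)) = fun y => - cross y (ngon R k (i + k.-1)).
  by move=> y; apply: cvgN; exact: ccross.
by apply/funext => z; rewrite /cross; ring.
Qed.

(** The support condition does not display a closed set. It is replaced by a finite union over the
    simplices [s] of the closed sets of points vanishing outside [s], all inside a cube. *)
Lemma compact_polyhedron (R : realType) (N : nat) (K : {set {set 'I_N}}) :
  simplicial_complex K -> compact (@polyhedron R N K).
Proof.
move=> [_ Kdown].
pose face (s : {set 'I_N}) : set 'rV[R]_N :=
  [set x | [/\ forall i, 0 <= x ord0 i, \sum_i x ord0 i = 1 &
               forall i, i \notin s -> x ord0 i = 0]].
have -> : @polyhedron R N K = \bigcup_(s in [set s | s \in K]) face s.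
  apply/seteqP; split=> [x [x0 x1 xK]|x [s sK [x0 x1 xs]]].
    exists (finset (fun i => x ord0 i != 0)) => //; split => // i.
    by rewrite inE negbK => /eqP.
  split=> //; apply: (Kdown _ _ sK).
    by apply/fintype.subsetP => i; rewrite inE; apply: contraNT => /xs ->.
  apply/negP => /eqP/setP E; move: x1.
  have -> : \sum_i x ord0 i = 0.
    by apply: big1 => i _; move: (E i); rewrite !inE => /negbT; rewrite negbK => /eqP.
  by move/esym/eqP; rewrite oner_eq0.
apply: (@subclosed_compact _ _
  [set x : 'rV[R]_N | forall i, `[(0:R), 1]%classic (x ord0 i)]).
- apply: closed_bigcup; first exact: finite_finset.
  move=> s _.
  have -> : face s = (\bigcap_i [set x : 'rV[R]_N | 0 <= x ord0 i]) `&`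
      ([set x : 'rV[R]_N | \sum_i x ord0 i = 1] `&`
       (\bigcap_(i in [set i | i \notin s]) [set x : 'rV[R]_N | x ord0 i = 0])).
    apply/seteqP; split=> x /=.
      by case=> h1 h2 h3; split; [move=> i _; exact: h1 | split].
    case=> h1 [h2 h3]; by split => // i; exact: h1.
  apply: closedI; last apply: closedI.
  + apply: closed_bigI => i _.
    apply: (@closed_comp _ _ (fun x : 'rV[R]_N => x ord0 i) [set y | 0 <= y]).
      by move=> x _; exact: coord_continuous.
    exact: closed_ge.
  + apply: (@closed_comp _ _ (fun x : 'rV[R]_N => \sum_i x ord0 i) [set y | y = 1]).
      by move=> x _; apply: continuous_sumr => i; exact: coord_continuous.
    exact: closed_eq.
  + apply: closed_bigI => i _.
    apply: (@closed_comp _ _ (fun x : 'rV[R]_N => x ord0 i) [set y | y = 0]).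
      by move=> x _; exact: coord_continuous.
    exact: closed_eq.
- apply: (@rV_compact _ _ (fun=> `[(0:R), 1]%classic)) => i.
  exact: segment_compact.
- move=> x [s _ [x0 x1 _]] i /=; rewrite in_itv /= x0 /= -x1.
  by rewrite (bigD1 i) //= lerDl sumr_ge0.
Qed.

(** * Vertex links as cycles *)

Section Link.
Variables (N : nat) (O : 'I_N -> 'I_N -> 'I_N -> bool) (v a0 c0 : 'I_N).
Hypotheses (surfO : oriented_surface O) (va0c0 : O v a0 c0).

(** Points off the link are fixed, which makes the successor an injection of the whole type, so that
    its iterates are periodic. *)
Definition link_next (a : 'I_N) : 'I_N := odflt a [pick b | O v a b].

Definition link_vertex (i : nat) : 'I_N := iter i link_next a0.

Definition link_size : nat := fingraph.order link_next a0.

Let nextP a b : O v a b -> link_next a = b.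
Proof.
rewrite /link_next => vab; case: pickP => [c vac|/(_ b)] /=; last by rewrite vab.
exact: (os_fun surfO vac vab).
Qed.

Let linkS a b : O v a b -> exists c, O v b c.
Proof. by move=> /(os_rot surfO)/(os_rot surfO)/(os_opp surfO). Qed.

Let link_next_inj : injective link_next.
Proof.
move=> a b; case: (pickP (O v a)) => [a' va|na]; case: (pickP (O v b)) => [b' vb|nb].
- rewrite (nextP va) (nextP vb) => ab; rewrite -ab in vb.
  exact: (os_fun surfO (os_rot surfO (os_rot surfO va))
                       (os_rot surfO (os_rot surfO vb))).
- rewrite (nextP va) /link_next; case: pickP => [c|_ ab] /=; first by rewrite nb.
  by have [c] := linkS va; rewrite ab nb.
- rewrite (nextP vb) /link_next; case: pickP => [c|_ ab] /=; first by rewrite na.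
  by have [c] := linkS vb; rewrite -ab na.
- rewrite /link_next; case: pickP => [c|_]; first by rewrite na.
  by case: pickP => [c|_]; first by rewrite nb.
Qed.

Lemma link_vertexP i : O v (link_vertex i) (link_vertex i.+1).
Proof.
elim: i => [|i IHi]; first by rewrite /link_vertex /= (nextP va0c0).
by have [c vc] := linkS IHi; rewrite [link_vertex i.+2](nextP vc).
Qed.

Lemma link_vertexD i : link_vertex (i + link_size) = link_vertex i.
Proof. by rewrite /link_vertex iterD iter_order. Qed.

Lemma link_vertex_inj i m m' : (m < link_size)%N -> (m' < link_size)%N ->
  link_vertex (i + m) = link_vertex (i + m') -> m = m'.
Proof.
rewrite /link_vertex !iterD => mk mk'.
have iter_inj : injective (iter i link_next).
  by elim: i => [//|i IHi] x y /link_next_inj /IHi.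
by move/iter_inj => e; rewrite -(findex_iter mk) e findex_iter.
Qed.

Lemma link_vertex_neq i : link_vertex i != v.
Proof. by have [] := os_neq surfO (link_vertexP i); rewrite eq_sym. Qed.

Lemma link_vertex_ex a b : O v a b ->
  exists2 i, (i < link_size)%N & a = link_vertex i.
Proof.
move=> vab; have := os_link surfO va0c0 vab.
rewrite (@eq_connect _ _ (fun x y => O v x y)) // => cab.
have {}cab : fconnect link_next a0 a.
  apply: connect_sub cab => x y vxy; apply: connect1.
  by rewrite /= (nextP vxy).
by exists (findex link_next a0 a); rewrite ?findex_max // /link_vertex iter_findex.
Qed.

(** Lengths 1, 2 and 3 contradict [os_neq], [os_asym] and [os_link_ge4] respectively. *)
Lemma link_size_ge4 : (4 <= link_size)%N.
Proof.
have L := link_vertexP; have n01 := os_neq surfO (L 0); have n12 := os_neq surfO (L 1).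
have Lk := link_vertexD 0; rewrite add0n in Lk.
have k0 : (0 < link_size)%N by rewrite fingraph.order_gt0.
case: link_size k0 Lk => [//|[|[|[|//]]]] _ E.
- by case: n01 => _ /eqP n _; case: n; rewrite E.
- have := L 1; rewrite E => v10; have := os_asym surfO (os_rot surfO v10).
  by rewrite (os_rot surfO (L 0)).
- by have := os_link_ge4 surfO (L 0) (L 1); rewrite -[X in O v _ X]E L.
Qed.

(** Renumbers the cycle from [i], so that the corners of the current sector get offsets 0 and 1. *)
Lemma link_index (T : Type) (F : nat -> T) i j : (j < link_size)%N ->
  (i < link_size)%N -> (forall j, F (j + link_size)%N = F j) ->
  exists m, [/\ (m < link_size)%N, link_vertex j = link_vertex (i + m) &
                F j = F (i + m)%N].
Proof.
move=> jk ik Fk; have [ij|ji] := leqP i j.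
  by exists (j - i)%N; rewrite subnKC // (leq_ltn_trans (leq_subr _ _) jk).
exists (j + link_size - i)%N; rewrite subnKC; last first.
  by rewrite (leq_trans (ltnW ik)) // leq_addl.
by rewrite link_vertexD Fk; split=> //; lia.
Qed.

Section Sparse.
Variables (V : nmodType) (G : 'I_N -> V) (i : nat).
Hypothesis sparseG : forall w, w != v -> w != link_vertex i ->
  w != link_vertex i.+1 -> G w = 0.

Lemma sparse_sum :
  \sum_w G w = G v + G (link_vertex i) + G (link_vertex i.+1).
Proof.
have [n1 n2 n3] := os_neq surfO (link_vertexP i).
rewrite (bigD1 v) // (bigD1 (link_vertex i)) ?link_vertex_neq //.
rewrite (bigD1 (link_vertex i.+1)) ?link_vertex_neq 1?eq_sym //.
rewrite big1 => [|w /andP[/andP[wv wi] wi1]]; last exact: sparseG.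
by rewrite /= addr0 addrA.
Qed.

Lemma sparse_vertex m : (1 < m)%N -> (m < link_size)%N ->
  G (link_vertex (i + m)) = 0.
Proof.
move=> m1 mk; apply: sparseG; first exact: link_vertex_neq.
- apply/eqP; rewrite -[X in _ = link_vertex X]addn0 => /link_vertex_inj.
  by move=> /(_ mk (leq_ltn_trans (leq0n _) mk)) E; rewrite E in m1.
- apply/eqP; rewrite -[X in _ = link_vertex X]addn1 => /link_vertex_inj.
  by move=> /(_ mk (leq_trans m1 (ltnW mk))) E; rewrite E in m1.
Qed.

End Sparse.

(** Rotated to start at [i], the sum keeps only its first two terms: for a point of one triangle at
    [v], a sum over all corners becomes a combination of two. *)
Lemma sparse_link_sum (R : nzRingType) (G : 'I_N -> R) (Q : nat -> R) i :
  (i < link_size)%N ->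
  (forall w, w != v -> w != link_vertex i -> w != link_vertex i.+1 -> G w = 0) ->
  (forall j, Q (j + link_size)%N = Q j) ->
  \sum_(j < link_size) G (link_vertex j) * Q j =
  G (link_vertex i) * Q i + G (link_vertex i.+1) * Q i.+1.
Proof.
move=> ik sG Qk; rewrite -(@periodic_sum _ _ i (fun j => G (link_vertex j) * Q j)).
  have := link_size_ge4; have := sparse_vertex sG.
  case: link_size => [//|[//|k]] spG _; rewrite big_ord_recl big_ord_recl /=.
  rewrite addn0 addn1 big1 ?addr0 // => m _.
  by rewrite spG ?mul0r //= /bump /= !add1n !ltnS ltn_ord.
by move=> j; rewrite link_vertexD Qk.
Qed.

End Link.

(** * Charts on open stars *)

Section Realization.
Variables (R : realType) (N : nat) (O : 'I_N -> 'I_N -> 'I_N -> bool).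
Hypothesis surfO : oriented_surface O.
Local Notation K := (complex_of O).
Local Notation P := (@polyhedron R N K).
Variable x0 : P.

(** The value [x0] off the polyhedron only makes the map total. *)
Definition to_polyhedron (y : 'rV[R]_N) : P := insubd x0 y.

Lemma to_polyhedronK y : P y -> set_val (to_polyhedron y) = y.
Proof. by move=> Py; rewrite set_valE /to_polyhedron insubdK // inE. Qed.

Lemma polyhedron_val (x : P) : P (set_val x).
Proof. by rewrite set_valE; have := valP x; rewrite inE. Qed.

Lemma to_polyhedron_val (x : P) : to_polyhedron (set_val x) = x.
Proof. by apply: val_inj; exact: (to_polyhedronK (polyhedron_val x)). Qed.

Lemma set_val_continuous : continuous (set_val : P -> 'rV[R]_N).
Proof. exact: initial_continuous. Qed.

Lemma coord_set_val_continuous w : continuous (fun x : P => set_val x ord0 w).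
Proof.
move=> x.
apply: (@continuous_comp P 'rV[R]_N R set_val (fun M : 'rV[R]_N => M ord0 w)).
  exact: set_val_continuous.
exact: coord_continuous.
Qed.

Lemma within_to_polyhedron (T : topologicalType) (A : set T) (r : T -> 'rV[R]_N) :
  continuous r -> (forall y, A y -> P (r y)) ->
  {within A, continuous (to_polyhedron \o r)}.
Proof.
move=> cr rP; apply: continuous_set_type.
apply: (@subspace_eq_continuous _ _ _ r); last exact: continuous_subspaceT.
by move=> y; rewrite inE => Ay /=; rewrite to_polyhedronK //; exact: rP.
Qed.

Lemma mem_polyhedron (x : 'rV[R]_N) (s : {set 'I_N}) : s \in K ->
  (forall i, 0 <= x ord0 i) -> \sum_i x ord0 i = 1 ->
  (forall i, i \notin s -> x ord0 i = 0) -> P x.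
Proof.
move=> sK x_ge0 x1 xs; split=> //; have [_ Kdown] := complex_of_simplicial O.
apply: (Kdown _ _ sK).
  by apply/fintype.subsetP => i; rewrite inE; apply: contraNT => /xs ->.
apply/negP => /eqP/setP E; move: x1; rewrite big1 => [/esym/eqP|i _].
  by rewrite oner_eq0.
by move: (E i); rewrite !inE => /negbT; rewrite negbK => /eqP.
Qed.

Lemma polyhedron_support (x : 'rV[R]_N) : P x -> exists u, x ord0 u != 0.
Proof.
move=> [_ x1 _]; apply: contrapT => /forallNP nx; move: x1.
rewrite big1 => [/esym/eqP|u _]; first by rewrite oner_eq0.
by apply/eqP; rewrite -[_ == _]negbK; apply/negP; exact: nx.
Qed.

Lemma polyhedron_star (x : 'rV[R]_N) v : P x -> x ord0 v != 0 ->
  exists a b, O v a b /\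
    forall w, w != v -> w != a -> w != b -> x ord0 w = 0.
Proof.
move=> [_ _ xK] xv.
have vx : v \in finset (fun i => x ord0 i != 0) by rewrite inE.
have [a [b [vab sub]]] := complex_of_star surfO xK vx.
exists a, b; split=> // w wv wa wb; apply/eqP.
have := contraNN (fintype.subsetP sub w).
by rewrite !inE !negb_or wv wa wb negbK; exact.
Qed.

(** On each triangle at [v] this is the affine map taking [v] to the origin and the link vertices to
    consecutive corners; the origin contributes no term. *)
Definition star_chart (v a : 'I_N) (x : P) : R * R :=
  (\sum_(j < link_size O v a) set_val x ord0 (link_vertex O v a j) *
     (ngon R (link_size O v a) j).1,
   \sum_(j < link_size O v a) set_val x ord0 (link_vertex O v a j) *
     (ngon R (link_size O v a) j).2).

(** Inverse of [star_chart] on the open polygon: the hats are the coordinates at the link vertices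
    and [v] receives the remainder. *)
Definition star_point (v a : 'I_N) (y : R * R) : 'rV[R]_N :=
  \row_w if w == v then 1 - \sum_(j < link_size O v a) hat (link_size O v a) j y
         else if [pick j : 'I_(link_size O v a) | w == link_vertex O v a j] is Some j
         then hat (link_size O v a) j y else 0.

Section Chart.
Variables (v a c : 'I_N).
Hypothesis vac : O v a c.
Local Notation k := (link_size O v a).
Local Notation L := (link_vertex O v a).
Local Notation Q := (ngon R k).

Let k4 : (4 <= k)%N. Proof. exact: (link_size_ge4 surfO vac). Qed.
Let Lk j : L (j + k)%N = L j. Proof. exact: (link_vertexD v a surfO). Qed.

Let star_pointL y j : (j < k)%N -> star_point v a y ord0 (L j) = hat k j y.
Proof.
move=> jk; rewrite mxE (negPf (link_vertex_neq surfO vac j)).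
case: pickP => [i /eqP E|/(_ (Ordinal jk))]; last by rewrite eqxx.
by have := @link_vertex_inj _ _ _ _ surfO 0 j i jk (ltn_ord i) E => ->.
Qed.

Let star_pointL' y j : star_point v a y ord0 (L j) = hat k j y.
Proof.
rewrite (divn_eq j k); elim: (j %/ k)%N => [|q IHq].
  by rewrite star_pointL // ltn_mod; case: k k4.
by rewrite mulSn -addnA addnC Lk (hatDk k4).
Qed.

Let star_point_sparse i s t : (i < k)%N -> 0 <= s -> 0 <= t ->
  let y := (s * (Q i).1 + t * (Q i.+1).1, s * (Q i).2 + t * (Q i.+1).2) in
  [/\ star_point v a y ord0 (L i) = s, star_point v a y ord0 (L i.+1) = t,
      star_point v a y ord0 v = 1 - (s + t) &
      forall w, w != v -> w != L i -> w != L i.+1 -> star_point v a y ord0 w = 0].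
Proof.
move=> ik s0 t0 y.
have hE m : (m < k)%N -> hat k (i + m) y = s *+ (m == 0)%N + t *+ (m == 1)%N.
  by move=> mk; exact: (hat_sector k4 i mk s0 t0).
have k0 : (0 < k)%N by exact: leq_trans k4.
have k1 : (1 < k)%N by exact: leq_trans k4.
have h0 : hat k i y = s by have := hE 0 k0; rewrite addn0 => ->; rewrite addr0.
have h1 : hat k i.+1 y = t by have := hE 1 k1; rewrite addn1 => ->; rewrite add0r.
split; rewrite ?star_pointL' //.
  rewrite mxE eqxx -(@periodic_sum _ _ i (fun j => hat k j y)); last first.
    by move=> j; rewrite (hatDk k4).
  congr (1 - _); under eq_bigr do rewrite hE //.
  case: k k1 => [//|[//|k'] _]; rewrite 2!big_ord_recl big1 => [|j _].
    by rewrite /= addr0 !mulr1n !mulr0n addr0 add0r.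
  by rewrite /= addr0.
move=> w wv wi wi1; rewrite mxE (negPf wv); case: pickP => // j /eqP wE.
have [|m [mk LE ->]] := link_index surfO vac (F := fun j => hat k j y) (ltn_ord j) ik.
  by move=> j'; rewrite (hatDk k4).
rewrite hE //; case: m mk LE => [|[|m]] mk LE; last by rewrite addr0.
  by rewrite wE LE addn0 eqxx in wi.
by rewrite wE LE addn1 eqxx in wi1.
Qed.

Let star_chart_sparse (x : 'rV[R]_N) i : (i < k)%N ->
  (forall w, w != v -> w != L i -> w != L i.+1 -> x ord0 w = 0) ->
  (\sum_(j < k) x ord0 (L j) * (Q j).1, \sum_(j < k) x ord0 (L j) * (Q j).2) =
  (x ord0 (L i) * (Q i).1 + x ord0 (L i.+1) * (Q i.+1).1,
   x ord0 (L i) * (Q i).2 + x ord0 (L i.+1) * (Q i.+1).2).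
Proof.
move=> ik xs.
have E (q : nat -> R) : (forall j, q (j + k)%N = q j) ->
    \sum_(j < k) x ord0 (L j) * q j = x ord0 (L i) * q i + x ord0 (L i.+1) * q i.+1.
  exact: (sparse_link_sum surfO vac (G := fun w => x ord0 w) ik xs).
congr pair; first by apply: (E (fun j => (Q j).1)) => j; rewrite (ngonDk _ k4).
by apply: (E (fun j => (Q j).2)) => j; rewrite (ngonDk _ k4).
Qed.

Let sector x : P x -> 0 < x ord0 v -> exists2 i, (i < k)%N &
  forall w, w != v -> w != L i -> w != L i.+1 -> x ord0 w = 0.
Proof.
move=> Px xv; have [|a' [b' [vab xs]]] := polyhedron_star (v := v) Px.
  by rewrite gt_eqF.
have [i ik aE] := link_vertex_ex surfO vac vab.
exists i => // w wv wi wi1; apply: xs => //; first by rewrite aE.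
by rewrite (os_fun surfO vab (_ : O v a' (L i.+1))) // aE (link_vertexP surfO vac).
Qed.

(** The open polygon is described by hats of sum less than 1, which says that the coordinate left
    for [v] is positive. A point of either side lies in one triangle or sector, where both maps
    involve two coordinates only and are visibly inverse. *)
Lemma star_chart_homeo :
  open [set x : P | 0 < set_val x ord0 v] /\
  exists V : set (R * R), open V /\
  homeomorphic [set x : P | 0 < set_val x ord0 v] V.
Proof.
split.
  apply: (@open_comp _ _ (fun x : P => set_val x ord0 v) [set r | 0 < r]).
    by move=> x _; exact: coord_set_val_continuous.
  exact: open_gt.
have csum : continuous (fun y : R * R => \sum_(j < k) hat k j y).
  by apply: continuous_sumr => j; exact: continuous_hat.
exists [set y | \sum_(j < k) hat k j y < 1]; split.
  apply: (@open_comp _ _ (fun y : R * R => \sum_(j < k) hat k j y) [set r | r < 1]).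
    by move=> y _; exact: csum.
  exact: open_lt.
have starP y : \sum_(j < k) hat k j y < 1 -> P (star_point v a y).
  move=> y1; have [i [s [t [ik s0 t0 yE]]]] := ngon_sector k4 y.
  have [e1 e2 e3 e4] := star_point_sparse ik s0 t0; rewrite -yE in e1 e2 e3 e4.
  have st : 0 < 1 - (s + t) by rewrite -e3 mxE eqxx subr_gt0.
  have tri : [set v; L i; L i.+1]%SET \in K.
    apply/complex_ofP; split; first by apply/set0Pn; exists v; rewrite !inE eqxx.
    by exists v, (L i), (L i.+1); split=> //; exact: (link_vertexP surfO vac i).
  apply: (mem_polyhedron tri).
  - move=> w; have [->|wv] := eqVneq w v; first by rewrite e3 ltW.
    have [->|wi] := eqVneq w (L i); first by rewrite e1.
    by have [->|wi1] := eqVneq w (L i.+1); rewrite ?e2 // e4.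
  - rewrite (sparse_sum surfO vac (G := fun w => star_point v a y ord0 w) e4).
    by rewrite e1 e2 e3; ring.
  - by move=> w; rewrite !inE !negb_or => /andP[/andP[wv wi] wi1]; exact: e4.
have chartK (x : P) : 0 < set_val x ord0 v ->
    star_point v a (star_chart v a x) = set_val x.
  move=> xv; have [i ik xs] := sector (polyhedron_val x) xv.
  have [xge0 x1 _] := polyhedron_val x.
  rewrite /star_chart (star_chart_sparse ik xs).
  have [e1 e2 e3 e4] := star_point_sparse ik (xge0 (L i)) (xge0 (L i.+1)).
  apply/rowP => w; have [->|wv] := eqVneq w v.
    rewrite e3 -x1 (sparse_sum surfO vac (G := fun w => set_val x ord0 w) xs).
    by ring.
  have [->|wi] := eqVneq w (L i); first exact: e1.
  have [->|wi1] := eqVneq w (L i.+1); first exact: e2.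
  by rewrite e4 // xs.
exists (star_chart v a), (to_polyhedron \o star_point v a).
split; [split|split].
- apply: continuous_subspaceT; apply: continuous_pair;
  apply: continuous_sumr => j; apply: continuous_mulr;
  exact: coord_set_val_continuous.
- apply: within_to_polyhedron => //; apply: continuous_rV => w y.
  under eq_fun do rewrite mxE.
  case: eqP => _; first by apply: cvgB; [exact: cvg_cst|exact: csum].
  by case: pickP => [j _|_]; [exact: continuous_hat | exact: cvg_cst].
- move=> _ [x /= xv <-]; have := congr1 (fun r : 'rV_N => r ord0 v) (chartK x xv).
  by rewrite mxE eqxx -subr_gt0 => ->.
- move=> _ [y /= y1 <-]; rewrite to_polyhedronK; last exact: starP.
  by rewrite mxE eqxx subr_gt0.
- by move=> x /= xv; rewrite chartK // to_polyhedron_val.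
move=> y /= y1; have Py := starP y y1.
rewrite /star_chart to_polyhedronK //.
have [i [s [t [ik s0 t0 yE]]]] := ngon_sector k4 y.
have [e1 e2 e3 e4] := star_point_sparse ik s0 t0; rewrite -yE in e1 e2 e3 e4.
by rewrite (star_chart_sparse ik e4) e1 e2.
Qed.

End Chart.
End Realization.

Lemma hausdorff_set_type (T : topologicalType) (B : set T) :
  hausdorff_space T -> hausdorff_space B.
Proof.
rewrite !open_hausdorff => hT x y xy.
have vxy : set_val x != set_val y by rewrite set_valE.
have [[A1 A2] /= [xA yA] [oA1 oA2 A12]] := hT _ _ vxy.
have cv : continuous (set_val : B -> T) by exact: initial_continuous.
exists (set_val @^-1` A1, set_val @^-1` A2) => /=.
  by rewrite !inE in xA yA *.
split; try by apply: open_comp => // z _; exact: cv.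
apply/eqP; rewrite -subset0 => z [/= z1 z2].
by move/eqP: A12 => A12; have : (A1 `&` A2) (set_val z) by []; rewrite A12.
Qed.

(** * The polyhedron as a closed orientable surface *)

Section ClosedSurface.
Variables (R : realType) (N : nat) (O : 'I_N -> 'I_N -> 'I_N -> bool).
Hypothesis surfO : oriented_surface O.
Local Notation K := (complex_of O).
Local Notation P := (@polyhedron R N K).

Definition vertex_point (u : 'I_N) : 'rV[R]_N := \row_w (w == u)%:R.

Definition segment (x y : 'rV[R]_N) (t : R) : 'rV[R]_N :=
  \row_w ((1 - t) * x ord0 w + t * y ord0 w).

Let sum_vertex_point u : \sum_w vertex_point u ord0 w = 1.
Proof.
rewrite (bigD1 u) //= big1 => [|w wu]; first by rewrite mxE eqxx addr0.
by rewrite mxE (negPf wu).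
Qed.

Lemma vertex_point_polyhedron u a b : O u a b -> P (vertex_point u).
Proof.
move=> uab; apply: (mem_polyhedron (s := [set u]%SET)).
- by rewrite vertex_complex_of //; apply/existsP; exists a; apply/existsP; exists b.
- by move=> i; rewrite mxE ler0n.
- exact: sum_vertex_point.
- by move=> i; rewrite mxE inE => /negPf ->.
Qed.

Lemma segment_polyhedron (x y : 'rV[R]_N) (s : {set 'I_N}) t : P x -> P y ->
  s \in K -> (forall i, i \notin s -> x ord0 i = 0) ->
  (forall i, i \notin s -> y ord0 i = 0) -> 0 <= t <= 1 -> P (segment x y t).
Proof.
move=> [x0 x1 _] [y0 y1 _] sK xs ys /andP[t0 t1].
apply: (mem_polyhedron sK).
- by move=> i; rewrite mxE addr_ge0 // mulr_ge0 // subr_ge0.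
- under eq_bigr do rewrite mxE.
  by rewrite big_split -!mulr_sumr /= x1 y1; ring.
- by move=> i si; rewrite mxE xs // ys // !mulr0 addr0.
Qed.

Lemma continuous_segment x y : continuous (segment x y).
Proof.
apply: continuous_rV => w; under eq_fun do rewrite mxE.
move=> t; apply: cvgD; apply: cvgMl; last exact: cvg_id.
by apply: cvgB; [exact: cvg_cst | exact: cvg_id].
Qed.

Lemma edge_segment_polyhedron u v c t : O u v c -> 0 <= t <= 1 ->
  P (segment (vertex_point u) (vertex_point v) t).
Proof.
move=> uvc; have [uv _ _] := os_neq surfO uvc.
apply: (segment_polyhedron (s := [set u; v]%SET)).
- exact: (vertex_point_polyhedron uvc).
- exact: (vertex_point_polyhedron (os_rot surfO uvc)).
- by rewrite edge_complex_of //; apply/existsP; exists c.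
- by move=> i; rewrite !inE negb_or mxE => /andP[/negPf ->].
- by move=> i; rewrite !inE negb_or mxE => /andP[_ /negPf ->].
Qed.

Section Pointed.
Variables a b c : 'I_N.
Hypothesis abc : O a b c.

Let x0 : P := exist _ (vertex_point a) (mem_set (vertex_point_polyhedron abc)).
Local Notation toP := (to_polyhedron x0).

Lemma closed_surface_polyhedron : closed_surface R P.
Proof.
have within_toP : {within P, continuous toP}.
  apply: (@within_to_polyhedron _ _ _ x0 _ P id) => //.
  by move=> x; exact: cvg_id.
have toPT : toP @` P = [set: P].
  apply/seteqP; split=> // x _; exists (set_val x); first exact: polyhedron_val.
  exact: to_polyhedron_val.
split.
- exact/hausdorff_set_type/norm_hausdorff.
- rewrite -toPT; apply: continuous_compact => //.
  exact: (compact_polyhedron (complex_of_simplicial O)).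
- have segC (x y : 'rV[R]_N) : (forall t, 0 <= t <= 1 -> P (segment x y t)) ->
      connected_component [set: P] (toP x) (toP y).
    move=> sP; pose S := (toP \o segment x y) @` `[0, 1].
    apply: (@connected_component_max _ _ S) => //.
    + exists 0; first by rewrite /= in_itv /= lexx ler01.
      by congr toP; apply/rowP => w; rewrite mxE; ring.
    + apply: connected_continuous_connected; first exact: segment_connected.
      apply: within_to_polyhedron; first exact: continuous_segment.
      by move=> t /=; rewrite in_itv; exact: sP.
    + exists 1; first by rewrite /= in_itv /= lexx ler01.
      by congr toP; apply/rowP => w; rewrite mxE; ring.
  (* A segment joins each point to a vertex of its support, and the vertices are joined along
     edges. *)
  suff -> : [set: P] = connected_component [set: P] (toP (vertex_point a)).
    exact: component_connected.
  apply/seteqP; split=> // x _.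
  have [x_ge0 x1 xK] := polyhedron_val x.
  have [u xu] := polyhedron_support (polyhedron_val x).
  have [u1 [u2 [uu1 _]]] := polyhedron_star surfO (polyhedron_val x) xu.
  apply: (@connected_component_trans _ _ (toP (vertex_point u))).
    have /connectP[p] := os_conn surfO abc uu1.
    elim: p (a) => [|w p IHp] a' /= => [_ ->|/andP[/existsP[z a'wz] wp] uE].
      exact: connected_component_refl.
    apply: connected_component_trans (IHp _ wp uE).
    by apply: segC => t; exact: (edge_segment_polyhedron a'wz).
  rewrite -[x](to_polyhedron_val x0); apply: (segC (vertex_point u) (set_val x)) => t t01.
  apply: (segment_polyhedron (s := finset (fun i => set_val x ord0 i != 0))) => //.
  - exact: (vertex_point_polyhedron uu1).
  - move=> i; rewrite inE mxE negbK => xi; case: eqP => // iu.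
    by rewrite -iu xi in xu.
  - by move=> i; rewrite inE negbK => /eqP.
(* Any vertex with nonzero coordinate has [x] in its open star. *)
move=> x; have [x_ge0 x1 _] := polyhedron_val x.
have [u xu] := polyhedron_support (polyhedron_val x).
have [u1 [u2 [uu1 _]]] := polyhedron_star surfO (polyhedron_val x) xu.
have [oU [V [oV UV]]] := star_chart_homeo surfO x0 uu1.
exists [set x : P | 0 < set_val x ord0 u], V; split=> //=.
by rewrite lt_neqAle eq_sym xu x_ge0.
Qed.

Lemma polyhedron_homeo : homeomorphic P [set: P].
Proof.
exists toP, set_val; split; [split|split] => //.
- apply: (@within_to_polyhedron _ _ _ x0 _ P id) => //.
  by move=> x; exact: cvg_id.
- by apply: continuous_subspaceT; exact: set_val_continuous.
- by move=> x Px; exact: to_polyhedronK.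
- by move=> x _; exact: to_polyhedron_val.
Qed.

Lemma closed_orientable_surface_polyhedron (g : nat) :
  euler_characteristic K = 2 - 2 * g%:Z -> closed_orientable_surface R P g.
Proof.
move=> chiK; split; first exact: closed_surface_polyhedron.
exists N, K; split => //.
- exact: complex_of_simplicial.
- by move=> s; exact: card_complex_of.
- exact: polyhedron_homeo.
- exact: orientable_complex_of.
Qed.

(** Among the graph vertices, the coordinates that are nonzero at an interior point of a segment are
    exactly those of its two ends. The point thus determines its edge, and distinct open edges are
    disjoint. *)
Lemma skeleton_is_embedding (V : finType) (e : rel V) (i : V -> 'I_N) :
  injective i -> (forall u, exists x y, O (i u) x y) ->
  (forall u v, e u v -> exists x, O (i u) (i v) x) ->
  is_embedding e (fun u => toP (vertex_point (i u)))
    (fun u v t => toP (segment (vertex_point (i u)) (vertex_point (i v)) t)).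
Proof.
move=> i_inj iO eO.
have Pv u : P (vertex_point (i u)).
  by have [x [y uxy]] := iO u; exact: (vertex_point_polyhedron uxy).
have Ps u v t : e u v -> 0 <= t <= 1 ->
    P (segment (vertex_point (i u)) (vertex_point (i v)) t).
  by move=> /eO[x uvx]; exact: (edge_segment_polyhedron uvx).
have in01 (t : R) : t \in `]0, 1[ -> 0 < t < 1 /\ 0 <= t <= 1.
  by rewrite in_itv /= => /andP[t0 t1]; rewrite t0 t1 !ltW.
have toP_inj x y : P x -> P y -> toP x = toP y -> x = y.
  by move=> Px Py /(congr1 set_val); rewrite !to_polyhedronK.
have supp u v t w : 0 < t < 1 ->
    (segment (vertex_point (i u)) (vertex_point (i v)) t ord0 (i w) != 0) =
    (w \in [set u; v]%SET).
  move=> /andP[t0 t1]; rewrite !mxE !inE !(inj_eq i_inj).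
  have {}t1 : 0 < 1 - t by rewrite subr_gt0.
  by case: (w == u); case: (w == v) => /=; rewrite ?mulr1 ?mulr0 ?addr0 ?add0r
    ?eqxx // gt_eqF // addr_gt0.
have neq u v : e u v -> u != v.
  by move=> /eO[x /(os_neq surfO)[uv _ _]]; apply: contraNneq uv => ->.
split=> [u v /(toP_inj _ _ (Pv u) (Pv v))/rowP/(_ (i u))|].
  by rewrite !mxE eqxx; case: eqP => [/i_inj //|_] /eqP; rewrite oner_eq0.
split=> [u v uv|].
  split.
  - apply: (within_to_polyhedron (r := segment _ _)); first exact: continuous_segment.
    by move=> t /=; rewrite in_itv; exact: Ps.
  - move=> s t; rewrite !in_itv /= => s01 t01.
    move=> /(toP_inj _ _ (Ps _ _ _ uv s01) (Ps _ _ _ uv t01))/rowP/(_ (i v)).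
    rewrite !mxE eqxx (inj_eq i_inj) eq_sym (negPf (neq _ _ uv)).
    by rewrite !mulr0 !add0r !mulr1.
  - by congr toP; apply/rowP => w; rewrite mxE; ring.
  - by congr toP; apply/rowP => w; rewrite mxE; ring.
  - by move=> t _; congr toP; apply/rowP => w; rewrite !mxE; ring.
split=> [u v w uv t /in01[t01 t01']|u v u' v' uv uv' neqs s t /in01[s01 s01'] /in01[t01 t01']].
  move=> /(toP_inj _ _ (Ps _ _ _ uv t01') (Pv w))/rowP E.
  have := supp u v t u t01; have := supp u v t v t01; rewrite !E !mxE !inE !eqxx orbT.
  rewrite !pnatr_eq0 !eqb0 !negbK => /eqP/i_inj vw /eqP/i_inj uw.
  by have := neq _ _ uv; rewrite vw uw eqxx.
move=> /(toP_inj _ _ (Ps _ _ _ uv s01') (Ps _ _ _ uv' t01'))/rowP E.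
case/eqP: neqs; apply/setP => w.
by rewrite -(supp u v s w s01) -(supp u' v' t w t01) E.
Qed.

End Pointed.

Lemma embeds_in_genus_skeleton (V : finType) (e : rel V) (i : V -> 'I_N) (g : nat) :
  injective i -> (0 < #|V|)%N -> (forall u, exists x y, O (i u) x y) ->
  (forall u v, e u v -> exists x, O (i u) (i v) x) ->
  euler_characteristic K = 2 - 2 * g%:Z -> embeds_in_genus R e g.
Proof.
move=> i_inj /card_gt0P[u _] iO eO chiK; have [x [y uxy]] := iO u.
exists P; split; first exact: (closed_orientable_surface_polyhedron uxy chiK).
by eexists; eexists; exact: (skeleton_is_embedding uxy i_inj iO eO).
Qed.

End ClosedSurface.

Local Close Scope classical_set_scope.

(** * The surface of a rotation system *)

Section Counting.
Variables (V D : finType) (tl : D -> V) (nd ed : {perm D}).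
Hypothesis rs : rotation_system tl nd ed.
Local Notation fc := (face_perm nd ed).
Local Notation tri := (map_triangle tl nd ed).
Local Notation W := (V + D + {set D})%type.

(** A set of darts lies in a triangle only if it is a cycle of [fc], so the other elements of
    [{set D}] are not counted. *)
Lemma card_map_vertices :
  #|[set a : W | [exists b, exists c, tri a b c]]%SET| =
  (#|V| + #|D| + #|porbits fc|)%N.
Proof.
rewrite -sum1_card !big_sumType /=.
have -> : (\sum_(v : V | inl (inl v) \in finset (fun a : W => [exists b, exists c, tri a b c])) 1
   = #|V|)%N.
  rewrite -sum1_card; apply: eq_bigl => v; rewrite !inE.
  have [d dv] := rs_tail rs v.
  apply/existsP; exists (inl (inl (tl (ed d)))); apply/existsP; exists (inl (inr d)).
  by rewrite /= dv !eqxx.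
have -> : (\sum_(d : D | inl (inr d) \in finset (fun a : W => [exists b, exists c, tri a b c])) 1
   = #|D|)%N.
  rewrite -sum1_card; apply: eq_bigl => d; rewrite !inE.
  apply/existsP; exists (inl (inl (tl d))); apply/existsP.
  by exists (inl (inl (tl (ed d)))); rewrite /= !eqxx.
congr (_ + _)%N; rewrite -sum1_card; apply: eq_bigl => z; rewrite !inE.
apply/existsP/imsetP => [[b /existsP[c]]|[x _ ->]].
  by case: b c => [[w|x]|w] [[w'|d]|w'] //= /andP[_ /eqP ->]; exists x.
exists (inl (inr x)); apply/existsP; exists (inl (inr (fc x))).
by rewrite /= !eqxx.
Qed.

(** Three triangles per dart, each read from any of its three vertices. *)
Lemma card_map_triangles :
  #|[set t : W * W * W | tri t.1.1 t.1.2 t.2]%SET| = (#|D| * 9)%N.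
Proof.
pose v d : W := inl (inl (tl d)); pose h d : W := inl (inl (tl (ed d))).
pose s d : W := inl (inr d); pose z d : W := inr (porbit fc d).
pose tris d := [:: (v d, h d, s d); (h d, s d, v d); (s d, v d, h d);
  (v (fc d), s (fc d), s d); (s (fc d), s d, v (fc d)); (s d, v (fc d), s (fc d));
  (z d, s d, s (fc d)); (s d, s (fc d), z d); (s (fc d), z d, s d)].
pose g (p : D * 'I_9) := nth (v p.1, v p.1, v p.1) (tris p.1) p.2.
pose g' (t : W * W * W) : option (D * nat) := match t with
  | (inl (inl _), inl (inl _), inl (inr d)) => Some (d, 0%N)
  | (inl (inl _), inl (inr d), inl (inl _)) => Some (d, 1%N)
  | (inl (inr d), inl (inl _), inl (inl _)) => Some (d, 2%N)
  | (inl (inl _), inl (inr _), inl (inr d)) => Some (d, 3%N)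
  | (inl (inr _), inl (inr d), inl (inl _)) => Some (d, 4%N)
  | (inl (inr d), inl (inl _), inl (inr _)) => Some (d, 5%N)
  | (inr _, inl (inr d), inl (inr _)) => Some (d, 6%N)
  | (inl (inr d), inl (inr _), inr _) => Some (d, 7%N)
  | (inl (inr _), inr _, inl (inr d)) => Some (d, 8%N)
  | _ => None end.
have gK p : g' (g p) = Some (p.1, p.2 : nat).
  by case: p => d [[|[|[|[|[|[|[|[|[|]]]]]]]]]].
have g_inj : injective g.
  move=> [d i] [d' j] /(congr1 g'); rewrite !gK => -[-> ij].
  by congr pair; apply: val_inj.
rewrite -[9%N]card_ord -card_prod -(card_imset _ g_inj); apply/eq_card => t.
rewrite inE; apply/idP/imsetP => [|[[d i] _ ->]]; last first.
  by case: i => [[|[|[|[|[|[|[|[|[|]]]]]]]]]]; rewrite /= ?eqxx.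
have use d i (lt_i9 : (i < 9)%N) : nth (v d, v d, v d) (tris d) i = t ->
    exists2 p, p \in predT & t = g p.
  by move=> <-; exists (d, Ordinal lt_i9).
case: t use => [[[[u|d]|y] [[w|x]|y']] [[w'|d']|y'']] use //= /andP[/eqP h1 /eqP h2].
- by apply: (use d' 0%N) => //; rewrite /= /v /h h1 h2.
- by apply: (use x 1%N) => //; rewrite /= /v /h h1 h2.
- by apply: (use d' 3%N) => //; rewrite /= /v /s -h1 h2.
- by apply: (use d 2%N) => //; rewrite /= /v /h h1 h2.
- by apply: (use d 5%N) => //; rewrite /= /v /s -h1 h2.
- by apply: (use x 4%N) => //; rewrite /= /v /s -h1 h2.
- by apply: (use d 7%N) => //; rewrite /= /z /s -h1 h2.
- by apply: (use d' 8%N) => //; rewrite /= /z /s -h1 h2.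
- by apply: (use x 6%N) => //; rewrite /= /z /s -h1 h2.
Qed.

End Counting.

Lemma connect_enum (W : finType) (e : rel W) x y : connect e x y ->
  connect (fun i j : 'I_#|W| => e (enum_val i) (enum_val j)) (enum_rank x) (enum_rank y).
Proof.
case/connectP => p + ->; elim: p x => [|w p IHp] x //= /andP[xw wp].
by apply: connect_trans (IHp _ wp); apply: connect1; rewrite !enum_rankK.
Qed.

(** Simplicial complexes live on ordinals, so the triangulation is transported along the enumeration
    of its vertex type. *)
Lemma oriented_surface_enum (W : finType) (O : W -> W -> W -> bool) :
  oriented_surface O ->
  oriented_surface (fun i j k : 'I_#|W| => O (enum_val i) (enum_val j) (enum_val k)).
Proof.
case=> rot fn opp asym link ge4 conn; split.
- by move=> a b c; exact: rot.
- by move=> a b c d abc abd; apply: enum_val_inj; exact: fn abc abd.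
- by move=> a b c /opp[d bad]; exists (enum_rank d); rewrite enum_rankK.
- by move=> a b c; exact: asym.
- by move=> v a b c d vab vcd; have := connect_enum (link _ _ _ _ _ vab vcd);
    rewrite !enum_valK.
- by move=> v a b c; exact: ge4.
move=> a b c a' b' c' abc abc'.
have := connect_enum (conn _ _ _ _ _ _ abc abc'); rewrite !enum_valK.
rewrite (@eq_connect _ _ (fun x y => [exists z : 'I_#|W|,
    O (enum_val x) (enum_val y) (enum_val z)])) // => x y.
by apply/existsP/existsP => -[z Oz]; [exists (enum_rank z); rewrite enum_rankK
  | exists (enum_val z)].
Qed.

Lemma rotation_system_embeds (R : realType) (V D : finType) (tl : D -> V)
    (nd ed : {perm D}) (e : rel V) (g : nat) :
  rotation_system tl nd ed -> (0 < #|V|)%N ->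
  (forall u v, e u v -> exists2 d, tl d = u & tl (ed d) = v) ->
  (2 * (#|V| + #|porbits (face_perm nd ed)|) + 4 * g = #|D| + 4)%N ->
  embeds_in_genus R e g.
Proof.
move=> rs V0 eD gE; pose W : finType := (V + D + {set D})%type.
set tri := map_triangle tl nd ed.
have surf := map_triangle_surface rs.
apply: (@embeds_in_genus_skeleton R _ _ (oriented_surface_enum surf) _ _
  (fun u => enum_rank (inl (inl u) : W))) => //.
- by move=> u v /enum_rank_inj[].
- move=> u; have [d du] := rs_tail rs u.
  exists (enum_rank (inl (inl (tl (ed d))) : W)), (enum_rank (inl (inr d) : W)).
  by rewrite !enum_rankK /= du !eqxx.
- move=> u v /eD[d du dv]; exists (enum_rank (inl (inr d) : W)).
  by rewrite !enum_rankK /= du dv !eqxx.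
have := euler_complex_of (oriented_surface_enum surf).
set chi := euler_characteristic _.
set A := finset _; set T := finset (fun t : _ * _ * _ => _) => chiE.
have AE : #|A| = (#|V| + #|D| + #|porbits (face_perm nd ed)|)%N.
  rewrite -(card_map_vertices rs) -(card_imset (mem A) (@enum_val_inj W _)).
  apply/eq_card => w; rewrite [RHS]inE; apply/imsetP/existsP => [[i iA ->]|[b /existsP[c wbc]]].
    move: iA; rewrite inE => /existsP[j /existsP[k ijk]].
    by exists (enum_val j); apply/existsP; exists (enum_val k).
  exists (enum_rank w); last by rewrite enum_rankK.
  rewrite !inE; apply/existsP; exists (enum_rank b).
  by apply/existsP; exists (enum_rank c); rewrite !enum_rankK.
have TE : #|T| = (#|D| * 9)%N.
  rewrite -(card_map_triangles tl nd ed).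
  pose f (t : 'I_#|W| * 'I_#|W| * 'I_#|W|) : W * W * W :=
    (enum_val t.1.1, enum_val t.1.2, enum_val t.2).
  have f_inj : injective f.
    by move=> [[a b] c] [[a' b'] c'] [/enum_val_inj -> /enum_val_inj -> /enum_val_inj ->].
  rewrite -(card_imset (mem T) f_inj); apply/eq_card => -[[a b] c].
  rewrite [RHS]inE; apply/imsetP/idP => [[[[i j] k] + [-> -> ->]]|abc].
    by rewrite inE.
  exists (enum_rank a, enum_rank b, enum_rank c); last by rewrite /f /= !enum_rankK.
  by rewrite inE /= !enum_rankK.
(* With D = 2E darts, 6(V + D + F) - 9D = 6(V - E + F): the subdivision keeps the Euler
   characteristic. *)
by move: chiE; rewrite AE TE; lia.
Qed.

Local Close Scope ring_scope.

(** * The burnt pancake graph *)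

Lemma iter_ordS n k (i : 'I_n) : iter k (@ordS n) i = (i + k) %% n :> nat.
Proof.
elim: k => [|k IHk] /=; first by rewrite addn0 modn_small.
by rewrite IHk addnS -[(_ %% n).+1]addn1 modnDml addn1.
Qed.

Lemma iter_ordS_ex n (i j : 'I_n) : exists k, iter k (@ordS n) i = j.
Proof.
exists (j + n - i); apply: val_inj; rewrite /= iter_ordS subnKC.
  by rewrite modnDr modn_small.
by rewrite (leq_trans (ltnW (ltn_ord i))) // leq_addl.
Qed.

Lemma ordS_neq n (i : 'I_n) : 1 < n -> ordS i != i.
Proof.
move=> n1; apply/eqP => /(congr1 val) /=.
move: (ltn_ord i); move: (nat_of_ord i) => m.
rewrite leq_eqVlt => /orP[/eqP mn|mn]; last by rewrite modn_small //; lia.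
by rewrite mn modnn; lia.
Qed.

Section BurntPancakeMap.
Variable n : nat.
Hypothesis n_ge3 : 3 <= n.
Local Notation G := (signed_permutation n).
Local Notation word u := (val (val u) : seq ('I_n * bool)).

Let n_gt0 : 0 < n. Proof. exact: leq_trans n_ge3. Qed.
Let n_gt1 : 1 < n. Proof. exact: leq_trans n_ge3. Qed.

Lemma size_word (u : G) : size (word u) = n.
Proof. exact: size_tuple. Qed.

Lemma uniq_word (u : G) : uniq [seq x.1 | x <- word u].
Proof. exact: valP u. Qed.

Fact size_flip i (u : G) : size (prefix_reversal i (word u)) == n.
Proof. by rewrite size_prefix_reversal size_word. Qed.

Fact uniq_flip i (u : G) : uniq [seq x.1 | x <- Tuple (size_flip i u)].
Proof. by rewrite /= (perm_uniq (perm_prefix_reversal _ _)) uniq_word. Qed.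

Definition flip i (u : G) : G := exist _ (Tuple (size_flip i u)) (uniq_flip i u).

Lemma word_flip i u : word (flip i u) = prefix_reversal i (word u).
Proof. by []. Qed.

Lemma word_inj (u v : G) : word u = word v -> u = v.
Proof. by move=> uv; apply: val_inj; apply: val_inj. Qed.

Lemma flipK i : involutive (flip i).
Proof. by move=> u; apply: word_inj; rewrite !word_flip prefix_reversalK. Qed.

Lemma burnt_pancakeP (u v : G) :
  reflect (exists i : 'I_n, v = flip i.+1 u) (burnt_pancake u v).
Proof.
apply: (iffP existsP) => -[i iP]; exists i; first by apply: word_inj; exact/eqP.
by rewrite iP.
Qed.

Lemma flip_neq (i : 'I_n) u : flip i.+1 u != u.
Proof.
apply/eqP => E; have := burnt_pancake_irrefl u.
suff -> : burnt_pancake u u by [].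
by apply/burnt_pancakeP; exists i.
Qed.

Lemma burnt_pancake_connected (u v : G) : connect (@burnt_pancake n) u v.
Proof.
have all_letters (w : G) : perm_eq [seq x.1 | x <- word w] (enum 'I_n).
  apply: uniq_perm; rewrite ?uniq_word ?enum_uniq //.
  apply: (uniq_min_size (uniq_word w) _ _).2; first by move=> x _; rewrite mem_enum.
  by rewrite size_enum_ord size_map (size_word w).
have [l [+ lE]] := prefix_reversals_sort
  (perm_trans (all_letters u) (etrans (perm_sym _ _) (all_letters v))).
rewrite size_word => lP.
have -> : v = foldl (fun w i => flip i w) u l.
  apply: word_inj; rewrite -lE; elim: (l) u {lP lE} => //= i l' IHl' u.
  by rewrite -IHl'.
elim: l u lP {lE} => [|[|i] l IHl] u //= /andP[ilt lP].
apply: connect_trans (IHl _ lP); apply: connect1; apply/burnt_pancakeP.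
by exists (Ordinal ilt).
Qed.

(* A two-colouring that the reversals r_1 and r_2 both switch. *)
Definition colour (u : G) : bool :=
  if word u is x :: y :: _ then x.2 (+) y.2 (+) (x.1 < y.1)%N else false.

Lemma word_cons2 (u : G) : exists x y s, word u = [:: x, y & s] /\ x.1 != y.1.
Proof.
have := size_word u; have := uniq_word u.
case: (word u) => [|x [|y s]] /=; try by move=> _; move: n_gt1; lia.
by rewrite inE negb_or => /andP[/andP[xy _] _] _; exists x, y, s.
Qed.

Lemma flip1_cons2 (x y : 'I_n * bool) s :
  prefix_reversal 1 [:: x, y & s] = [:: (x.1, ~~ x.2), y & s].
Proof. by []. Qed.

Lemma flip2_cons2 (x y : 'I_n * bool) s :
  prefix_reversal 2 [:: x, y & s] = [:: (y.1, ~~ y.2), (x.1, ~~ x.2) & s].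
Proof. by rewrite /prefix_reversal /= take0 drop0. Qed.

Lemma colour_flip1 u : colour (flip 1 u) = ~~ colour u.
Proof.
have [x [y [s [uE _]]]] := word_cons2 u.
by rewrite /colour word_flip uE flip1_cons2 /= !addNb.
Qed.

(** The two sign changes cancel, while exchanging the symbols reverses their comparison. For r_1 it
    is the single sign change that counts. *)
Lemma colour_flip2 u : colour (flip 2 u) = ~~ colour u.
Proof.
have [x [y [s [uE xy]]]] := word_cons2 u.
rewrite /colour word_flip uE flip2_cons2 /= addNb addbN negbK [y.2 (+) x.2]addbC.
rewrite -addbN; congr (_ (+) _).
by case: (ltngtP x.1 y.1) => // /val_inj E; rewrite E eqxx in xy.
Qed.

(** On the first two letters r_1 followed by r_2 sends (x, y) to (-y, x), a quarter turn. *)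
Lemma flip21_order4 u : flip 2 (flip 1 (flip 2 (flip 1
  (flip 2 (flip 1 (flip 2 (flip 1 u))))))) = u.
Proof.
have [[a b] [[c d] [s [uE _]]]] := word_cons2 u.
by apply: word_inj; rewrite !word_flip uE !(flip1_cons2, flip2_cons2) /= !negbK.
Qed.

(** Indices start at 0: the dart [(u, i)] leaves [u] along r_(i+1). *)
Definition dart_edge (d : G * 'I_n) : G * 'I_n := (flip d.2.+1 d.1, d.2).

Definition dart_node (d : G * 'I_n) : G * 'I_n :=
  (d.1, if colour d.1 then ord_pred d.2 else ordS d.2).

Lemma dart_edgeK : involutive dart_edge.
Proof. by move=> [u i]; rewrite /dart_edge /= flipK. Qed.

Lemma dart_node_inj : injective dart_node.
Proof.
move=> [u i] [v j] [<-]; case: ifP => _ => [/ord_pred_inj|/ordS_inj] -> //.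
Qed.

Definition edge_perm : {perm G * 'I_n} := perm (inv_inj dart_edgeK).
Definition node_perm : {perm G * 'I_n} := perm dart_node_inj.
Local Notation fc := (face_perm node_perm edge_perm).

Let faceE d d' : dart_node d' = dart_edge d -> fc d = d'.
Proof.
move=> E; apply: (@perm_inj _ node_perm).
by rewrite /face_perm permM permKV !permE.
Qed.

Lemma node_perm_neq d : node_perm d != d.
Proof.
rewrite permE; case: d => u i; rewrite /dart_node xpair_eqE eqxx /=.
case: (colour u); last exact: ordS_neq.
by apply: contraNneq (ordS_neq (ord_pred i) n_gt1) => E; rewrite ord_predK E.
Qed.

Lemma node_perm1 d : (node_perm d).1 = d.1. Proof. by rewrite permE. Qed.

Lemma face1 d : (fc d).1 = flip d.2.+1 d.1.
Proof. by rewrite -node_perm1 /face_perm permM permKV permE. Qed.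

(** Turning about a vertex changes the index, so consecutive steps of a face use different
    reversals; this feeds [prefix_reversal_no_triangle]. *)
Lemma face2_neq d : d.2 != (fc d).2.
Proof.
have := node_perm_neq (fc d); apply: contraNneq => E.
have -> : node_perm (fc d) = ((fc d).1, d.2).
  by rewrite face1 /face_perm permM permKV permE.
by rewrite E -surjective_pairing.
Qed.

Lemma burnt_pancake_rotation_system :
  rotation_system (fun d : G * 'I_n => d.1) node_perm edge_perm.
Proof.
split.
- by move=> d; rewrite !permE dart_edgeK.
- by move=> v; exists (v, Ordinal n_gt0).
- move=> [u i] [v j]; apply/eqP/porbitP => /= [<-|[k E]]; last first.
    have : forall k, ((node_perm ^+ k)%g (u, i)).1 = u.
      elim=> [|k' IH]; first by rewrite expg0 perm1.
      by rewrite expgSr permM node_perm1.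
    by move/(_ k); rewrite -E.
  have up k (i' : 'I_n) : colour u = false ->
      ((node_perm ^+ k)%g (u, i')) = (u, iter k (@ordS n) i').
    move=> cu; elim: k => [|k IHk]; first by rewrite expg0 perm1.
    by rewrite expgSr permM IHk permE /dart_node /= cu.
  (* Where the rotation is reversed the orbit is walked from its far end, which exchanges [i] and
     [j] below. *)
  have down k (i' : 'I_n) : colour u = true ->
      ((node_perm ^+ k)%g (u, iter k (@ordS n) i')) = (u, i').
    move=> cu; elim: k => [|k IHk]; first by rewrite expg0 perm1.
    by rewrite expgS permM permE /dart_node /= cu ordSK.
  case cu: (colour u).
    by have [k <-] := iter_ordS_ex j i; exists k; rewrite down.
  by have [k <-] := iter_ordS_ex i j; exists k; rewrite up.
- move=> [u i] [v j] /= <-; rewrite !permE /= => /(congr1 (fun w : G => word w)).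
  rewrite !word_flip => /prefix_reversal_inj_index E; congr pair; apply: val_inj.
  by apply: E; rewrite ?uniq_word ?size_word ?ltn_ord.
- by move=> d; rewrite permE flip_neq.
- exact: node_perm_neq.
(* A face of length 3 would be a product of three reversals, cyclically distinct, fixing a word. *)
- move=> d; apply/eqP => E.
  have E1 : word (flip (fc (fc d)).2.+1 (flip (fc d).2.+1 (flip d.2.+1 d.1))) = word d.1.
    by rewrite -[in RHS]E !face1.
  have n2 (x : G * 'I_n) : (x.2 : nat) != (fc x).2 by have := face2_neq x; rewrite -val_eqE.
  apply: (@prefix_reversal_no_triangle _ d.2 (fc d).2 (fc (fc d)).2 (word d.1)) E1;
    rewrite ?uniq_word ?size_word ?ltn_ord //.
  by rewrite -[in X in _ != X]E.
- move=> u v; apply: connect_sub (burnt_pancake_connected u v) => x y.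
  move=> /burnt_pancakeP[i ->]; apply: connect1; apply/existsP; exists (x, i).
  by rewrite permE /= !eqxx.
Qed.

(** * Faces alternating r_1 and r_2 *)

Let i0 : 'I_n := Ordinal n_gt0.
Let i1 : 'I_n := Ordinal n_gt1.

Let i01 : ordS i0 = i1.
Proof. by apply: val_inj; rewrite /= modn_small. Qed.

Let i10 : ord_pred i1 = i0. Proof. by rewrite -i01 ordSK. Qed.

Let short_dart (u : G) : G * 'I_n := (u, if colour u then i1 else i0).

(** Arriving by r_2 at a vertex of colour false, the inverse of the increasing rotation leads to
    r_1; arriving by r_1 at the other colour, the inverse of the decreasing one leads to r_2. *)
Let face_short u :
  fc (short_dart u) = short_dart (flip (if colour u then 2 else 1) u).
Proof.
apply: faceE; rewrite /dart_node /dart_edge /short_dart /=.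
case cu: (colour u); rewrite /= ?colour_flip1 ?colour_flip2 cu /=.
  by rewrite i01.
by rewrite i10.
Qed.

Let face8 u : (fc ^+ 8)%g (short_dart u) = short_dart u.
Proof.
have even v : colour v = false -> (fc ^+ 8)%g (short_dart v) = short_dart v.
  have two w : colour w = false ->
      fc (fc (short_dart w)) = short_dart (flip 2 (flip 1 w)) /\
      colour (flip 2 (flip 1 w)) = false.
    move=> cw; have c1 : colour (flip 1 w) = true by rewrite colour_flip1 cw.
    by rewrite colour_flip2 c1 face_short cw face_short c1.
  have p8 (p : {perm G * 'I_n}) d : (p ^+ 8)%g d = p (p (p (p (p (p (p (p d))))))).
    by rewrite !(expgS, expg0) !permM perm1.
  move=> cv; rewrite p8.
  have [-> c2] := two _ cv; have [-> c4] := two _ c2.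
  by have [-> c6] := two _ c4; have [-> _] := two _ c6; rewrite flip21_order4.
(* For the other colour, one step of the face reaches the case just treated, and the eighth power
   commutes with that step. *)
case cu: (colour u); last exact: even.
have comm (p : {perm G * 'I_n}) d : (p ^+ 8)%g (p d) = p ((p ^+ 8)%g d).
  by rewrite -!permM -expgS expgSr.
have := even (flip 2 u); rewrite colour_flip2 cu => /(_ erefl).
have <- : fc (short_dart u) = short_dart (flip 2 u) by rewrite face_short cu.
by rewrite comm => /perm_inj.
Qed.

(** The short darts, one per vertex, are covered by the short faces, each of at most 8 darts;
    already these faces are numerous enough. *)
Lemma card_faces_ge : #|{: G}| <= #|porbits fc| * 8.
Proof.
have small u : #|porbit fc (short_dart u)| <= 8.
  suff sub : porbit fc (short_dart u) \subset
      [set (fc ^+ (i : 'I_8))%g (short_dart u) | i in 'I_8]%SET.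
    rewrite (leq_trans (subset_leq_card sub)) //.
    by rewrite (leq_trans (leq_imset_card _ _)) // card_ord.
  apply/fintype.subsetP => x /porbitP[k ->]; apply/imsetP.
  exists (Ordinal (ltn_pmod k (isT : 0 < 8))) => //=.
  rewrite {1}(divn_eq k 8) expgD permM; congr (_ _).
  elim: (k %/ 8) => [|q IHq]; first by rewrite expg0 perm1.
  by rewrite mulSn expgD permM face8.
pose Z := [set porbit fc (short_dart u) | u : G]%SET.
have inj : injective short_dart by move=> u v [].
rewrite -(card_imset _ inj).
have : #|[set short_dart u | u : G]%SET| <= #|finset.cover Z|.
  apply/subset_leq_card/fintype.subsetP => _ /imsetP[u _ ->].
  by apply/finset.bigcupP; exists (porbit fc (short_dart u)); [exact: imset_f | exact: porbit_id].
move/leq_trans; apply; apply: leq_trans (leq_card_cover Z).1 _.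
have ZP : Z \subset porbits fc.
  by apply/fintype.subsetP => _ /imsetP[u _ ->]; exact: imset_f.
apply: (@leq_trans (#|Z| * 8)); last by rewrite leq_mul2r subset_leq_card.
by rewrite -sum_nat_const; apply: leq_sum => _ /imsetP[u _ ->].
Qed.

(** Separating symbols from signs is injective. The estimate is later multiplied by [4 * n - 9],
    which is positive for n at least 3. *)
Lemma card_signed_permutation_le : #|{: G}| <= 2 ^ n * n`!.
Proof.
pose f (u : G) : {t : n.-tuple 'I_n | all predT t && uniq t} * n.-tuple bool :=
  (exist _ [tuple of map (fun x => x.1) (val u)]
     (introT andP (conj (all_predT _) (uniq_word u))),
   [tuple of map (fun x => x.2) (val u)]).
have f_inj : injective f.
  move=> u v fuv; apply: word_inj.
  have : [seq x.1 | x <- word u] = [seq x.1 | x <- word v].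
    exact: (congr1 (fun p => val (val p.1) : seq 'I_n) fuv).
  have : [seq x.2 | x <- word u] = [seq x.2 | x <- word v].
    exact: (congr1 (fun p => val p.2 : seq bool) fuv).
  elim: (word u) (word v) => [|[a b] s IHs] [|[c d] t] //= [-> st2] [-> st1].
  by rewrite (IHs t).
rewrite (leq_trans (leq_card f f_inj)) // card_prod card_tuple card_bool mulnC.
rewrite leq_mul2l card_sig.
have := card_uniq_tuples n (@predT 'I_n); rewrite card_ord ffactnn => <-.
by rewrite cardsE leqnn orbT.
Qed.

(** Euler's equation 2(V + F) + 4g = nV + 4, multiplied by 4, with 8F replaced by its lower bound V:
    this is the origin of 9 and 16. Keeping 9V on the left avoids a truncated subtraction. *)
Lemma burnt_pancake_embeds (R : realType) : exists g,
  embeds_in_genus R (@burnt_pancake n) g /\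
  16 * g + 9 * #|{: G}| <= 4 * n * #|{: G}| + 16.
Proof.
have rs := burnt_pancake_rotation_system.
have G_gt0 : 0 < #|{: G}|.
  apply/card_gt0P.
  have su : size [seq (i, false) | i <- enum 'I_n] == n.
    by rewrite size_map size_enum_ord.
  have uu : uniq [seq x.1 | x <- Tuple su].
    by rewrite /= -map_comp map_id enum_uniq.
  by exists (exist _ (Tuple su) uu).
have [g gE] := rotation_system_genus rs G_gt0; exists g; split.
  apply: (rotation_system_embeds R rs G_gt0 _ gE) => u v /burnt_pancakeP[i ->].
  by exists (u, i); rewrite ?permE.
have := card_faces_ge; move: gE; rewrite card_prod card_ord.
move: #|porbits _| #|{: G}| => F V.
nia.
Qed.

End BurntPancakeMap.

(** * The genus bound *)

Local Open Scope ring_scope.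

Theorem theorem4p7 (R : realType) (n : nat) (n_ge3 : (3 <= n)%N) :
  exists g : nat, is_genus R (@burnt_pancake n) g /\
    (g%:R : rat) <= 2 ^ (n%:Z - 4) * (4 * n%:R - 9) * n`!%:R + 1.
Proof.
have [g [gemb gle]] := burnt_pancake_embeds n_ge3 R.
pose P h := `[< embeds_in_genus R (@burnt_pancake n) h >].
have exP : exists h, P h by exists g; exact/asboolP.
exists (ex_minn exP); case: ex_minnP => m mP mmin; split.
  by split; [exact/asboolP | move=> h hP; apply: mmin; exact/asboolP].
have mg : (m <= g)%N by apply: mmin; exact/asboolP.
have Gle := card_signed_permutation_le n.
have key : (16 * m <= (4 * n - 9) * (2 ^ n * n`!) + 16)%N.
  have le9 : (9 <= 4 * n)%N by lia.
  have : ((4 * n - 9) * #|{: signed_permutation n}| <= (4 * n - 9) * (2 ^ n * n`!))%N.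
    by rewrite leq_mul2l Gle orbT.
  rewrite mulnBl; move: mg gle; lia.
(* The exponent is an integer, equal to -1 for n = 3, so the power is read in the rationals as a
   quotient. *)
have -> : 2 ^ (n%:Z - 4) = 2 ^+ n / 16 :> rat.
  by rewrite expfzDr // -exprnP; congr (_ * _).
have : (16 * m)%:R <= ((4 * n - 9) * (2 ^ n * n`!) + 16)%:R :> rat by rewrite ler_nat.
rewrite natrD !natrM natrX natrB; last by lia.
rewrite natrM; move: (2 ^+ n) (n`!%:R : rat) (n%:R : rat) (m%:R : rat) => a b c d; lra.
Qed.
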